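(* Let $A$ be a Banach algebra with a bounded approximate identity and an $F\ell^1(\eta)$-base $\mathscr L$ for some infinite cardinal $\eta$ and some integer $m\in\mathbb N$ ($m=1$ for types 1 and 2). Let $X=\bigcup_{k=1}^mX_k\subseteq LUC(A)^*$ with $X_k=\{\Psi_{pk}:p\in\mathscr C(\eta)\}$, and let $\widetilde X\subseteq A^{**}$ consist of one fixed norm-preserving extension to $A^*$ of each element of $X$. Let $\mathscr S$ be any subsemigroup or subalgebra of $LUC(A)^*$ with $X\subseteq\mathscr S$, or any subsemigroup or subalgebra of $A^{**}$ with $\widetilde X\subseteq\mathscr S$. Then: (1) if $\mathscr L$ is of type 1 or type 2 and $\mathscr S$ is a subsemigroup, then there are at least $2^{2^\eta}$ many disjoint principal left ideals in $\mathscr S$; if $\mathscr S$ is a subalgebra, these left ideals have zero pairwise intersections; (2) if $\mathscr L$ is of type 3, then there are at least $2^{2^\eta}$ many principal left ideals in $\mathscr S$; (3) if $\mathscr S$ is a subalgebra, then the dimension of each of these left ideals is at least $2^{2^\eta}$.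
   Context: Dimension means vector space dimension. Products. $\langle S\cdot a,b\rangle=\langle S,ab\rangle$ for $S\in A^*$, $a,b\in A$. $LUC(A)$ is the closed linear span of $\{S\cdot a:S\in A^*,a\in A\}$ in $A^*$. For $\Psi$ in $A^{**}$ or $LUC(A)^*$, $\langle\Psi\cdot S,a\rangle=\langle\Psi,S\cdot a\rangle$. $A^{**}$ and $LUC(A)^*$ carry the first Arens product $\langle\Phi\Psi,S\rangle=\langle\Phi,\Psi\cdot S\rangle$ ($S\in A^*$, resp. $S\in LUC(A)$); subsemigroups and subalgebras are taken with respect to this product. Right multipliers. $M_r(A)$ is the algebra of bounded operators $R$ on $A$ with $R(ab)=aR(b)$, with product $R_1R_2=R_2\circ R_1$; $A$ sits in $M_r(A)$ by right multiplications, and $aR=R(a)\in A$ for $a\in A$. With a bounded approximate identity (bai) $(e_i)$, $R\in M_r(A)$ is viewed in $LUC(A)^*$ as the weak$^*$-limit of $(R(e_i))$, i.e. $\langle R,S\cdot a\rangle=\langle S,aR\rangle$. $\langle E\rangle$ denotes linear span; cardinals are identified with initial ordinals. $\ell^1(\eta)$-base with constant $K>0$: a bounded set $\{x_\alpha:\alpha<\eta\}$ in a normed space such that $\sum_{n=1}^p|z_n|\le K\|\sum_{n=1}^pz_nx_{\alpha_n}\|$ for all $p\in\mathbb N$, all scalars $z_1,\dots,z_p$ and all distinct elements $x_{\alpha_1},\dots,x_{\alpha_p}$ of the set. $\ell^1(\eta)$-selective base with constant $K_1>0$: a bounded set $\mathscr L=\bigcup_{\alpha<\eta}\mathscr L_\alpha$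 with each $\mathscr L_\alpha$ nonempty, such that the spans $\langle\mathscr L_\alpha\rangle$ have zero pairwise intersections and $\sum_{n=1}^p\|x_n\|\le K_1\|\sum_{n=1}^px_n\|$ whenever $x_n\in\langle\mathscr L_{\alpha_n}\rangle$ for $n=1,\dots,p$, with $\alpha_1,\dots,\alpha_p$ distinct. Zooming set in $A$ (with a bai): a set $\bigcup_{\alpha<\eta}A_\alpha a_\alpha$ where (i) $\{A_\alpha\}_{\alpha<\eta}$ is an increasing family of subsets of $A$ with $A_\eta=\bigcup_{\alpha<\eta}A_\alpha$ bounded (one may assume the bound is $1$) and of closed linear span $A$; (ii) $\{a_\alpha:\alpha<\eta\}$ is bounded in $M_r(A)$; (iii) the spans $\langle A_\alpha a_\alpha\rangle$, $\alpha<\eta$, have zero pairwise intersections. $F\ell^1(\eta)$-base of type 1: a zooming set that is an $\ell^1(\eta)$-base. Type 2: a zooming set that is an $\ell^1(\eta)$-selective base (with $\mathscr L_\alpha=A_\alpha a_\alpha$) such that for some $K_2>0$, $\|a\|\le K_2\|aa_\alpha\|$ for all $a\in\langle A_\alpha\rangle$, $\alpha<\eta$. Type 3: a zooming $\ell^1(\eta)$-selective base of the form $\bigcup_{\alpha<\eta}A_\alpha\{a_\alpha^k:k=1,\dots,m\}$ (with $\mathscr L_\alpha=\bigcup_{k=1}^mA_\alpha a_\alpha^k$), where $\{A_\alpha\}$ is as in (i), $\{\mathbf a_\alpha=(a_\alpha^k)_{k=1}^m:\alpha<\eta\}$ is bounded in $M_r(A)^m$, condition (iii) means that for each $k$ the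 spans $\langle A_\alpha\rangle a_\alpha^k$, $\alpha<\eta$, have zero pairwise intersections, and for some $K_2>0$, $\|a\|\le K_2\|(aa_\alpha^k)_{k=1}^m\|$ for all $a\in\langle A_\alpha\rangle$, $\alpha<\eta$ (any of the $p$-norms, $p=1,2,\dots,\infty$). For types 1 and 2 put $m=1$, $a_\alpha^1=a_\alpha$. Cluster points. $\mathscr C(\eta)$ is the set of cofinal ultrafilters on $\eta$ (all members cofinal in $\eta$). For $p\in\mathscr C(\eta)$ and $k\le m$, $\Psi_{pk}\in LUC(A)^*$ is the weak$^*$-limit along $p$ of $\alpha\mapsto a_\alpha^k\in M_r(A)\subseteq LUC(A)^*$.
   Formalization: A is assumed nonzero; in a type 1 base, distinct pairs (α,a) with a in A_α are required to give distinct elements a·a_α; and when 0 lies in the subsemigroup S, ''disjoint'' left ideals means disjoint outside 0. *)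

(* Defs.v *)
From HB Require Import structures.
From mathcomp Require Import all_boot all_order all_algebra.
From mathcomp Require Import complex.
From mathcomp Require Import all_classical all_reals.
From mathcomp Require Import topology normedtype.

Set Implicit Arguments.
Unset Strict Implicit.
Unset Printing Implicit Defensive.

Import Order.TTheory GRing.Theory Num.Theory numFieldNormedType.Exports.

Local Open Scope classical_set_scope.
Local Open Scope ring_scope.
Local Open Scope complex_scope.

HB.mixin Record CompleteNormedModule_isBanachAlgebra (K : numFieldType) A
    & CompleteNormedModule K A := {
  bmul : A -> A -> A;
  bmulA : associative bmul;
  bmulDl : left_distributive bmul +%R;
  bmulDr : right_distributive bmul +%R;
  bmulZl : forall (k : K) (a b : A), bmul (k *: a) b = k *: bmul a b;
  bmulZr : forall (k : K) (a b : A), bmul a (k *: b) = k *: bmul a b;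
  ler_norm_bmul : forall a b : A, `|bmul a b| <= `|a| * `|b|
}.

(* Not necessarily unital, hence independent of algType. *)
#[short(type="banachAlgType")]
HB.structure Definition BanachAlgebra (K : numFieldType) :=
  {A of CompleteNormedModule_isBanachAlgebra K A & CompleteNormedModule K A}.

Declare Scope banach_scope.
Delimit Scope banach_scope with B.
Notation "a ** b" := (bmul a b) (at level 40, left associativity) : banach_scope.
Local Open Scope banach_scope.

Section LinearSpan.
Variables (K : numFieldType) (V : lmodType K).

Definition span (E : set V) : set V :=
  [set v | exists (n : nat) (z : 'I_n -> K) (x : 'I_n -> V),
     (forall i, E (x i)) /\ v = \sum_(i < n) z i *: x i].

Definition lin_indep (B : set V) :=
  forall (n : nat) (z : 'I_n -> K) (x : 'I_n -> V),
    (forall i, B (x i)) -> injective x ->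
    \sum_(i < n) z i *: x i = 0 -> forall i, z i = 0.

Definition basis_of_set (L B : set V) :=
  [/\ B `<=` L, lin_indep B & span B = L].

Lemma span0 (E : set V) : span E 0.
Proof.
exists 0%N, (fun=> 0), (fun=> 0); split=> [[]//|].
by rewrite big_ord0.
Qed.

Lemma spanP (E : set V) (k : K) (u v : V) :
  span E u -> span E v -> span E (k *: u + v).
Proof.
move=> [n [z [x [Ex ->]]]] [p [w [y [Ey ->]]]].
exists (n + p)%N,
  (fun i : 'I_(n + p) => match fintype.split i with inl j => k * z j | inr j => w j end),
  (fun i : 'I_(n + p) => match fintype.split i with inl j => x j | inr j => y j end).
split=> [i|]; first by case: (fintype.split i).
rewrite big_split_ord /= scaler_sumr; congr (_ + _).
  apply: eq_bigr => i _.
  by have /= -> := unsplitK (inl i : 'I_n + 'I_p)%type; rewrite scalerA.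
apply: eq_bigr => i _.
by have /= -> := unsplitK (inr i : 'I_n + 'I_p)%type.
Qed.

End LinearSpan.

(* The dual of a complex normed space, with the operator norm. *)
Section Dual.
Variables (R : realType) (V : normedModType R[i]).

Definition bounded_functional : {pred V -> R[i]^o} := fun f =>
  `[< linear f /\ exists M : R[i], forall x, `|f x| <= M * `|x| >].

Fact bounded_functional_submod : submod_closed bounded_functional.
Proof.
split.
  apply/asboolP; split=> [k x y|]; first by rewrite /= scaler0 addr0.
  by exists 0 => x; rewrite normr0 mul0r.
move=> k f g /asboolP[lf [M fM]] /asboolP[lg [N gN]].
apply/asboolP; split=> [c x y|].
  rewrite !fctE lf lg !scalerDr !scalerA [k * c]mulrC.
  by rewrite addrACA.
exists (`|k| * M + N) => x; rewrite !fctE mulrDl.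
rewrite (le_trans (ler_normD _ _))// lerD//.
by rewrite normrZ -mulrA ler_wpM2l.
Qed.

HB.instance Definition _ := GRing.isSubmodClosed.Build R[i]
  (V -> R[i]^o) bounded_functional bounded_functional_submod.

Record dual := Dual {
  dual_fun :> V -> R[i]^o ;
  dual_funP : dual_fun \in bounded_functional }.

HB.instance Definition _ := [isSub for dual_fun].
HB.instance Definition _ := [Choice of dual by <:].
HB.instance Definition _ := [SubChoice_isSubLmodule of dual by <:].

Lemma dualP (f g : dual) : f =1 g -> f = g.
Proof. by move=> fg; apply/val_inj/funext. Qed.

Lemma dual_linear (f : dual) : linear f.
Proof. by have /asboolP[] := dual_funP f. Qed.

HB.instance Definition _ (f : dual) :=
  GRing.isLinear.Build R[i] V R[i]^o _ (dual_fun f) (dual_linear f).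

Definition dual_norm (f : dual) : R[i] :=
  (sup [set complex.Re `|f x| | x in [set x : V | `|x| <= 1]])%:C.

Lemma ge0_Re (z : R[i]) : 0 <= z -> (complex.Re z)%:C = z.
Proof. by move=> z0; apply: RRe_real; exact: ger0_real. Qed.

Lemma dual_bound (f : dual) : exists2 M : R, 0 <= M &
  forall x, `|f x| <= M%:C * `|x|.
Proof.
have /asboolP[_ [M fM]] := dual_funP f.
have MC : (complex.Re `|M|)%:C = `|M| by exact: ge0_Re.
exists (complex.Re `|M|); first by rewrite -ler0c MC.
move=> x; rewrite MC (le_trans (fM x))//.
have M0 : 0 <= M * `|x| by rewrite (le_trans _ (fM x)).
by rewrite -[leLHS]ger0_norm// normrM normr_id.
Qed.

Lemma dual_norm_has_sup (f : dual) :
  has_sup [set complex.Re `|f x| | x in [set x : V | `|x| <= 1]].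
Proof.
split; first by exists (complex.Re `|f 0|), 0 => //; rewrite /mkset normr0.
have [M M0 fM] := dual_bound f.
exists M => _ [x x1 <-]; rewrite -lecR ge0_Re// (le_trans (fM x))//.
by rewrite ler_piMr// ler0c.
Qed.

Lemma dual_norm_ge0 (f : dual) : 0 <= dual_norm f.
Proof.
rewrite ler0c (@le_trans _ _ (complex.Re `|f 0|))//.
  by rewrite -ler0c ge0_Re.
apply: (sup_upper_bound (dual_norm_has_sup f)).
by exists 0 => //; rewrite /mkset normr0.
Qed.

Lemma ler_dual_norm (f : dual) (x : V) : `|f x| <= dual_norm f * `|x|.
Proof.
have [->|x0] := eqVneq x 0; first by rewrite linear0 !normr0 mulr0.
have x_gt0 : 0 < `|x| by rewrite normr_gt0.
rewrite -ler_pdivrMr// mulrC.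
have -> : `|x|^-1 * `|f x| = `|f (`|x|^-1 *: x)|.
  by rewrite linearZ normrZ normfV normr_id.
rewrite -[leLHS]ge0_Re// lecR.
apply: (sup_upper_bound (dual_norm_has_sup f)).
exists (`|x|^-1 *: x) => //.
by rewrite /mkset normrZ normfV normr_id mulVf ?lt0r_neq0.
Qed.

Lemma dual_norm_le (f : dual) (M : R[i]) :
  0 <= M -> (forall x, `|f x| <= M * `|x|) -> dual_norm f <= M.
Proof.
move=> M0 fM; rewrite /dual_norm -(ge0_Re M0) lecR.
apply: ge_sup; first by case: (dual_norm_has_sup f).
move=> _ [x x1 <-].
rewrite -lecR ge0_Re// ge0_Re// (le_trans (fM x))//.
by rewrite ler_piMr.
Qed.

Fact dual_normD (f g : dual) :
  dual_norm (f + g) <= dual_norm f + dual_norm g.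
Proof.
apply: dual_norm_le => [|x]; first by rewrite addr_ge0 ?dual_norm_ge0.
by rewrite mulrDl (le_trans (ler_normD _ _))// lerD// ler_dual_norm.
Qed.

Fact dual_normZ_le (k : R[i]) (f : dual) :
  dual_norm (k *: f) <= `|k| * dual_norm f.
Proof.
apply: dual_norm_le => [|x]; first by rewrite mulr_ge0 ?dual_norm_ge0.
by rewrite [leLHS]normrZ -mulrA ler_wpM2l// ler_dual_norm.
Qed.

Fact dual_normZ (k : R[i]) (f : dual) :
  dual_norm (k *: f) = `|k| * dual_norm f.
Proof.
apply/le_anti; rewrite dual_normZ_le/=.
have [->|k0] := eqVneq k 0; first by rewrite normr0 mul0r dual_norm_ge0.
have {1}-> : f = k^-1 *: (k *: f) by rewrite scalerA mulVf// scale1r.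
rewrite -ler_pdivlMl ?normr_gt0// -normfV.
exact: dual_normZ_le.
Qed.

Fact dual_norm0_eq0 (f : dual) : dual_norm f = 0 -> f = 0.
Proof.
move=> f0; apply: dualP => x; apply/normr0_eq0/le_anti.
by rewrite normr_ge0 andbT (le_trans (ler_dual_norm f x))// f0 mul0r.
Qed.

HB.instance Definition _ := Lmodule_isNormed.Build R[i] dual
  dual_normD dual_normZ dual_norm0_eq0.

Lemma ler_dual (f : dual) (x : V) : `|f x| <= `|f| * `|x|.
Proof. exact: ler_dual_norm. Qed.

Fact mk_dual_subproof (f : V -> R[i]^o) : linear f ->
  (exists M : R[i], forall x, `|f x| <= M * `|x|) -> f \in bounded_functional.
Proof. by move=> lf bf; apply/asboolP. Qed.

Definition mk_dual (f : V -> R[i]^o) (lf : linear f)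
    (bf : exists M : R[i], forall x, `|f x| <= M * `|x|) : dual :=
  Dual (mk_dual_subproof lf bf).

End Dual.

Section ArensProducts.
Variables (R : realType) (A : banachAlgType R[i]).

(* The right action of A on its dual: <S . a, b> = <S, a b>. *)
Section RightAction.
Variables (S : dual A) (a : A).

Fact ract_linear : linear (fun b => S (a ** b)).
Proof. by move=> k b c; rewrite bmulDr bmulZr linearP. Qed.

Fact ract_bounded :
  exists M : R[i], forall b, `|S (a ** b)| <= M * `|b|.
Proof.
exists (`|S| * `|a|) => b; rewrite (le_trans (ler_dual S _))//.
by rewrite -mulrA ler_wpM2l// ler_norm_bmul.
Qed.

Definition ract : dual A := mk_dual ract_linear ract_bounded.

End RightAction.

Lemma ler_norm_ract (S : dual A) (a : A) : `|ract S a| <= `|S| * `|a|.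
Proof.
apply: dual_norm_le => [|b]; first by rewrite mulr_ge0.
by rewrite (le_trans (ler_dual S _))// -mulrA ler_wpM2l// ler_norm_bmul.
Qed.

Lemma ract_linearl (a : A) (k : R[i]) (S T : dual A) :
  ract (k *: S + T) a = k *: ract S a + ract T a.
Proof. exact: dualP. Qed.

Lemma ract_linearr (S : dual A) (k : R[i]) (a b : A) :
  ract S (k *: a + b) = k *: ract S a + ract S b.
Proof. by apply: dualP => c /=; rewrite bmulDl bmulZl linearP. Qed.

Lemma ract_mul (S : dual A) (a b : A) : ract S (a ** b) = ract (ract S a) b.
Proof. by apply: dualP => c /=; rewrite bmulA. Qed.

Definition luc_pred : {pred dual A} := fun f =>
  `[< closure (span [set ract S a | S in setT & a in setT]) f >].

Lemma luc_predP (f : dual A) : reflect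
  (forall e : R[i], 0 < e -> exists2 g : dual A,
     span [set ract S a | S in setT & a in setT] g & `|f - g| < e)
  (f \in luc_pred).
Proof.
apply: (iffP (asboolP _)) => [cf e e0|fP U].
  have [g [? ?]] := cf _ (nbhsx_ballx f e e0).
  by exists g => //; move: b; rewrite -ball_normE.
move=> /nbhs_ballP[e /= e0 eU]; have [g ? fg] := fP e e0.
by exists g; split => //; apply: eU; rewrite -ball_normE.
Qed.

Fact luc_submod : submod_closed luc_pred.
Proof.
split.
  by apply/luc_predP => e e0; exists 0; [exact: span0|rewrite subrr normr0].
move=> k f g /luc_predP fP /luc_predP gP; apply/luc_predP => e e0.
have k1 : 0 < `|k| + 1 by rewrite ltr_wpDl.
have [f' sf ff'] := fP (e / 2 / (`|k| + 1)) ltac:(by rewrite !divr_gt0).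
have [g' sg gg'] := gP (e / 2) ltac:(by rewrite divr_gt0).
exists (k *: f' + g'); first exact: spanP.
have -> : k *: f + g - (k *: f' + g') = k *: (f - f') + (g - g').
  by rewrite opprD addrACA scalerBr.
rewrite (le_lt_trans (ler_normD _ _))// [e]splitr ler_ltD//.
rewrite normrZ (le_trans (ler_wpM2l _ (ltW ff')))// mulrCA ler_piMr//.
  by rewrite divr_ge0// ltW.
by rewrite ler_pdivrMr// mul1r lerDl.
Qed.

HB.instance Definition _ := GRing.isSubmodClosed.Build R[i]
  (dual A) luc_pred luc_submod.

(* LUC(A), with the norm of the dual of A. *)
Record luc := Luc { luc_val :> dual A ; lucP : luc_val \in luc_pred }.

HB.instance Definition _ := [isSub for luc_val].
HB.instance Definition _ := [Choice of luc by <:].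
HB.instance Definition _ := [SubChoice_isSubLmodule of luc by <:].

Fact luc_normD (f g : luc) :
  `|luc_val (f + g)| <= `|luc_val f| + `|luc_val g|.
Proof. exact: ler_normD. Qed.

Fact luc_normZ (k : R[i]) (f : luc) :
  `|luc_val (k *: f)| = `|k| * `|luc_val f|.
Proof. exact: normrZ. Qed.

Fact luc_norm0_eq0 (f : luc) : `|luc_val f| = 0 -> f = 0.
Proof. by move=> /normr0_eq0 f0; exact: val_inj. Qed.

HB.instance Definition _ := Lmodule_isNormed.Build R[i] luc
  luc_normD luc_normZ luc_norm0_eq0.

Lemma luc_ract (S : dual A) (a : A) : ract S a \in luc_pred.
Proof.
apply/luc_predP => e e0; exists (ract S a); last by rewrite subrr normr0.
exists 1%N, (fun=> 1), (fun=> ract S a); split=> [_|].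
  by exists S => //; exists a.
by rewrite big_ord1 scale1r.
Qed.

Definition lucact (S : dual A) (a : A) : luc := Luc (luc_ract S a).

(* <Psi . S, a> = <Psi, S . a>, for Psi in the bidual. *)
Section BidualAction.
Variables (Psi : dual (dual A)) (S : dual A).

Fact biact_linear : linear (fun a => Psi (ract S a)).
Proof. by move=> k a b; rewrite ract_linearr linearP. Qed.

Fact biact_bounded :
  exists M : R[i], forall a, `|Psi (ract S a)| <= M * `|a|.
Proof.
exists (`|Psi| * `|S|) => a; rewrite (le_trans (ler_dual Psi _))//.
by rewrite -mulrA ler_wpM2l// ler_norm_ract.
Qed.

Definition biact : dual A := mk_dual biact_linear biact_bounded.

End BidualAction.

Lemma ler_norm_biact (Psi : dual (dual A)) (S : dual A) :
  `|biact Psi S| <= `|Psi| * `|S|.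
Proof.
apply: dual_norm_le => [|a]; first by rewrite mulr_ge0.
by rewrite (le_trans (ler_dual Psi _))// -mulrA ler_wpM2l// ler_norm_ract.
Qed.

Section FirstArensProduct.
Variables Phi Psi : dual (dual A).

Fact arens_linear : linear (fun S => Phi (biact Psi S)).
Proof.
move=> k S T; rewrite -linearP; congr (Phi _).
by apply: dualP => a /=; rewrite ract_linearl linearP.
Qed.

Fact arens_bounded :
  exists M : R[i], forall S, `|Phi (biact Psi S)| <= M * `|S|.
Proof.
exists (`|Phi| * `|Psi|) => S; rewrite (le_trans (ler_dual Phi _))//.
by rewrite -mulrA ler_wpM2l// ler_norm_biact.
Qed.

Definition arens : dual (dual A) := mk_dual arens_linear arens_bounded.

End FirstArensProduct.

(* <Psi . S, a> = <Psi, S . a>, for Psi in the dual of LUC(A). *)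
Section LucDualAction.
Variable Psi : dual luc.

Section Functional.
Variable S : dual A.

Fact lucdact_linear : linear (fun a => Psi (lucact S a)).
Proof.
move=> k a b; rewrite -linearP; congr (Psi _).
by apply: val_inj => /=; rewrite ract_linearr.
Qed.

Fact lucdact_bounded :
  exists M : R[i], forall a, `|Psi (lucact S a)| <= M * `|a|.
Proof.
exists (`|Psi| * `|S|) => a; rewrite (le_trans (ler_dual Psi _))//.
by rewrite -mulrA ler_wpM2l//; exact: ler_norm_ract.
Qed.

Definition lucdact : dual A := mk_dual lucdact_linear lucdact_bounded.

End Functional.

Lemma ler_norm_lucdact (S : dual A) : `|lucdact S| <= `|Psi| * `|S|.
Proof.
apply: dual_norm_le => [|a]; first by rewrite mulr_ge0.
rewrite (le_trans (ler_dual Psi _))// -mulrA ler_wpM2l//.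
exact: ler_norm_ract.
Qed.

Lemma lucdact_linearP (k : R[i]) (S T : dual A) :
  lucdact (k *: S + T) = k *: lucdact S + lucdact T.
Proof.
apply: dualP => a /=; rewrite -[RHS]linearP; congr (Psi _).
by apply: val_inj => /=; rewrite ract_linearl.
Qed.

Lemma lucdact_ract (S : dual A) (a : A) :
  lucdact (ract S a) = ract (lucdact S) a.
Proof.
apply: dualP => b /=; congr (Psi _).
by apply: val_inj => /=; rewrite ract_mul.
Qed.

Lemma luc_lucdact (f : luc) : lucdact f \in luc_pred.
Proof.
have P1 : 0 < `|Psi| + 1 by rewrite ltr_wpDl.
apply/luc_predP => e e0.
have /luc_predP/(_ (e / (`|Psi| + 1)) ltac:(by rewrite divr_gt0))[g sg fg] :=
  lucP f.
exists (lucdact g); last first.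
  have -> : lucdact f - lucdact g = lucdact (luc_val f - g).
    by rewrite addrC -scaleN1r -lucdact_linearP scaleN1r addrC.
  rewrite (le_lt_trans (ler_norm_lucdact _))//.
  rewrite (@le_lt_trans _ _ ((`|Psi| + 1) * `|luc_val f - g|))//.
    by rewrite ler_wpM2r// lerDl.
  by rewrite -ltr_pdivlMl// mulrC.
have [n [z [x [Ex ->]]]] := sg.
exists n, z, (fun i => lucdact (x i)); split=> [i|].
  have [S _ [a _ <-]] := Ex i.
  by exists (lucdact S) => //; exists a => //; rewrite lucdact_ract.
pose L : {linear dual A -> dual A} := HB.pack lucdact
  (GRing.isLinear.Build R[i] (dual A) (dual A) _ lucdact lucdact_linearP).
rewrite -[lucdact]/(L : _ -> _) linear_sum.
by apply: eq_bigr => i _; rewrite linearZ.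
Qed.

Definition lucdact_luc (f : luc) : luc := Luc (luc_lucdact f).

End LucDualAction.

Section FirstArensProductLuc.
Variables Phi Psi : dual luc.

Fact arens_luc_linear : linear (fun f => Phi (lucdact_luc Psi f)).
Proof.
move=> k f g; rewrite -linearP; congr (Phi _).
by apply: val_inj => /=; rewrite lucdact_linearP.
Qed.

Fact arens_luc_bounded :
  exists M : R[i], forall f, `|Phi (lucdact_luc Psi f)| <= M * `|f|.
Proof.
exists (`|Phi| * `|Psi|) => f; rewrite (le_trans (ler_dual Phi _))//.
by rewrite -mulrA ler_wpM2l//; exact: ler_norm_lucdact.
Qed.

Definition arens_luc : dual luc := mk_dual arens_luc_linear arens_luc_bounded.

End FirstArensProductLuc.

(* A bounded approximate identity, indexed by a filter rather than by a
   directed set. *)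
Definition bounded_approximate_identity (I : Type) (F : set_system I)
    (e : I -> A) :=
  bounded_set (range e) /\
  forall a, e i ** a @[i --> F] --> a /\ a ** e i @[i --> F] --> a.

Record right_multiplier := RightMultiplier {
  rmul_fun :> A -> A ;
  rmul_linear : linear rmul_fun ;
  rmul_bounded : exists M : R[i], forall x, `|rmul_fun x| <= M * `|x| ;
  rmulM : forall a b, rmul_fun (a ** b) = a ** rmul_fun b }.

(* The right multiplier r as a functional on LUC(A): the weak*-limit of
   r (e_i), the elements of A being seen as evaluations. *)
Definition rmul_luc (I : Type) (F : set_system I) (e : I -> A)
    (r : right_multiplier) (f : luc) : R[i]^o :=
  lim (f (r (e i)) @[i --> F]).

End ArensProducts.

(* An infinite cardinal as an initial ordinal: a well-ordered infinite type
   all of whose proper initial segments have smaller cardinality. *)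
Definition infinite_initial_ordinal (d : Order.disp_t) (T : orderType d) :=
  [/\ infinite_set [set: T],
      wochoice.well_order (<=%O : rel T) &
      forall t : T, ~ ([set: T] #<= [set s : T | (s < t)%O])%card].

Definition cofinal_ultrafilter (d : Order.disp_t) (T : orderType d)
    (p : set_system T) :=
  UltraFilter p /\
  forall B : set T, p B -> forall t : T, exists2 s, B s & (t <= s)%O.

Section Fl1Bases.
Variables (R : realType) (d : Order.disp_t) (T : orderType d).

Definition zero_intersections (V : lmodType R[i]) (W : T -> set V) :=
  forall s t : T, s != t -> W s `&` W t = [set 0].

Definition l1_base (V : normedModType R[i]) (x : T -> V) :=
  bounded_set (range x) /\
  exists2 K : R[i], 0 < K &
    forall (s : seq T) (z : T -> R[i]), uniq s ->
      \sum_(t <- s) `|z t| <= K * `|\sum_(t <- s) z t *: x t|.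

Definition l1_selective_base (V : normedModType R[i]) (L : T -> set V) :=
  [/\ bounded_set (\bigcup_t L t),
      forall t, L t !=set0,
      zero_intersections (fun t => span (L t)) &
      exists2 K1 : R[i], 0 < K1 &
        forall (s : seq T) (x : T -> V), uniq s ->
          {in s, forall t, span (L t) (x t)} ->
          \sum_(t <- s) `|x t| <= K1 * `|\sum_(t <- s) x t|].

Variable A : banachAlgType R[i].
Implicit Types (AA : T -> set A) (a : T -> right_multiplier A).

Definition zooming_family AA :=
  [/\ forall s t : T, (s <= t)%O -> AA s `<=` AA t,
      bounded_set (\bigcup_t AA t) &
      closure (span (\bigcup_t AA t)) = setT].

Definition bounded_multipliers a :=
  exists M : R[i], forall t x, `|a t x| <= M * `|x|.

Definition zooming_set AA a :=
  [/\ zooming_family AA, bounded_multipliers a &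
      zero_intersections (fun t => span (a t @` AA t))].

(* The zooming set is the family of the x a_alpha indexed by the pairs
   (alpha, x) with x in A_alpha, enumerated by eta through e.  Distinct pairs
   are required to give distinct elements: forgetting this and looking only at
   the set of the values x a_alpha would allow x a_alpha to depend only on
   alpha, and left ideals as below to be one-dimensional. *)
Definition fl1_base_type1 AA a :=
  zooming_set AA a /\
  exists e : T -> T * A,
    set_bij setT [set i | AA i.1 i.2] e /\
    l1_base (fun t => a (e t).1 (e t).2).

Definition fl1_base_type2 AA a :=
  [/\ zooming_set AA a,
      l1_selective_base (fun t => a t @` AA t) &
      exists2 K2 : R[i], 0 < K2 &
        forall t x, span (AA t) x -> `|x| <= K2 * `|a t x|].

(* The p-norms on A^m being equivalent, the 1-norm is used in the last
   clause. *)
Definition fl1_base_type3 (m : nat) AA (a : 'I_m -> T -> right_multiplier A) :=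
  [/\ zooming_family AA,
      forall k, bounded_multipliers (a k),
      forall k, zero_intersections (fun t => a k t @` span (AA t)),
      l1_selective_base (fun t => \bigcup_k (a k t @` AA t)) &
      exists2 K2 : R[i], 0 < K2 &
        forall t x, span (AA t) x -> `|x| <= K2 * \sum_(k < m) `|a k t x|].

Definition fl1_base_type12 (m : nat) AA
    (a : 'I_m -> T -> right_multiplier A) :=
  m = 1%N /\
  ((forall k, fl1_base_type1 AA (a k)) \/ (forall k, fl1_base_type2 AA (a k))).

(* The set X_k, for the multipliers a = (a_alpha^k)_alpha. *)
Definition cluster_points (I : Type) (F : set_system I) (e : I -> A) a :
    set (dual (luc A)) :=
  [set Psi | exists2 p : set_system T, cofinal_ultrafilter p &
     forall f, rmul_luc F e (a t) f @[t --> p] --> Psi f].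

End Fl1Bases.

Section LeftIdeals.
Variables (K : numFieldType) (V : lmodType K) (mul : V -> V -> V).
Implicit Types S L : set V.

Definition subsemigroup S :=
  S !=set0 /\ forall x y, S x -> S y -> S (mul x y).

Definition subalgebra S :=
  [/\ S 0, forall (k : K) x y, S x -> S y -> S (k *: x + y) &
      forall x y, S x -> S y -> S (mul x y)].

Definition principal_left_ideal S L :=
  exists2 x, S x & L = [set mul s x | s in S].

(* dim L >= |J|, the dimension being the cardinality of a basis *)
Definition dim_ge (J : Type) L :=
  exists2 B, basis_of_set L B & ([set: J] #<= B)%card.

(* There are at least |J| principal left ideals in S, which are pairwise
   disjoint if "disj" holds.  When 0 belongs to S, all left ideals contain 0,
   and disjointness can only mean disjointness outside of 0.  When S is a
   subalgebra these ideals have dimension at least |J|, and zero pairwise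
   intersections if "disj" holds. *)
Definition many_principal_left_ideals (J : Type) (disj : Prop) S :=
  exists LL : set (set V),
    [/\ ([set: J] #<= LL)%card,
        LL `<=` principal_left_ideal S,
        disj -> (~ S 0 -> trivIset LL id) /\
                trivIset LL (fun L => L `\ 0),
        disj -> subalgebra S -> forall L1 L2, LL L1 -> LL L2 -> L1 <> L2 ->
          L1 `&` L2 = [set 0] &
        subalgebra S -> forall L, LL L -> dim_ge J L].

End LeftIdeals.

(* Main.v *)
(* A functional on A can be prescribed on an Fl1-base: by Hahn-Banach, for every
   P : set T and every S in A* there is S' in A* with
   <S', x a_t^k> = 1_P(t) <S, x a_t^k> for x in A_t, and for every S0 in A* there
   are S^1, ..., S^m in A* with sum_k <S^k, x a_t^k> = <S0, x> for x in A_t.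
   In the limit along a cofinal ultrafilter p, Psi_pk . S' is Psi_pk . S if P is
   in p and 0 otherwise, while sum_k Psi_pk . S^k = S0.
   Hence, choosing P in p and not in q, Phi Psi_pk = Phi' Psi_ql forces
   Phi Psi_pk = 0 when p <> q, so that for all three types of bases the left
   ideals generated by Psi_pk and Psi_ql meet in 0 at most; moreover Phi = 0 if
   Phi Psi_pk = 0 for all k.  In the same way, choosing for each q some k(q) with
   Psi_qk(q) <> 0 yields a linearly independent family.  As Phi |-> (Phi Psi_pk)_k
   is injective and J := 2^(2^eta) satisfies J * J = J, one of its m components
   sends some J-indexed independent family to an independent family, which gives
   the ideal attached to p. *)
Require Import Defs.
From HB Require Import structures.
From mathcomp Require Import all_boot all_order all_algebra.
From mathcomp Require Import complex.
From mathcomp Require Import all_classical all_reals.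
From mathcomp Require Import topology normedtype.
From mathcomp Require Import ring.

Set Implicit Arguments.
Unset Strict Implicit.
Unset Printing Implicit Defensive.

Import Order.TTheory GRing.Theory Num.Theory numFieldNormedType.Exports.

Local Open Scope classical_set_scope.
Local Open Scope ring_scope.
Local Open Scope complex_scope.

(** * Arithmetic of infinite cardinals, from Zorn's lemma *)

Section Cardinals.

Lemma injective_card_le (T U : Type) (B : set U) (f : T -> U) :
  injective f -> (forall x, B (f x)) -> ([set: T] #<= B)%card.
Proof.
move=> finj fB; apply: (@card_le_trans _ _ _ (range f)).
  have /card_eqPle[] // : (range f #= [set: T])%card.
  by apply: inj_card_eq => x y _ _; exact: finj.
by apply: subset_card_le => _ [x _ <-].
Qed.

Lemma infinite_inj (T : Type) : infinite_set [set: T] ->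
  exists i : nat -> T, injective i.
Proof.
elim/Ppointed: T => T; first by rewrite emptyE => /(_ (finite_set0 _)).
move=> /infiniteP/pcard_leTP[f].
by exists f => x y; apply: inj; rewrite inE.
Qed.

(** Comparability of cardinals: a maximal graph of a partial bijection between [A] and [B] exhausts
    one of them, since otherwise a pair of unmatched points could be added. *)
Lemma set_inj_total (T : Type) (A B : set T) :
  (exists f : T -> T, {in A &, injective f} /\ f @` A `<=` B) \/
  (exists f : T -> T, {in B &, injective f} /\ f @` B `<=` A).
Proof.
pose P (G : set (T * T)) := (forall u, G u -> A u.1 /\ B u.2) /\
  (forall u v, G u -> G v -> u.1 = v.1 <-> u.2 = v.2).
have [F FP totF|G [[GAB Ginj] Gmax]] := @Zorn_bigcup _ P.
  split=> [u [G FG Gu]|u v [G FG Gu] [H FH Hv]]; first exact: (FP _ FG).1.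
  have [GH|HG] := totF _ _ FG FH.
    by apply: (FP _ FH).2 => //; exact: GH.
  by apply: (FP _ FG).2 => //; exact: HG.
have [domG|/existsNP[x /not_implyP[Ax xG]]] :=
    pselect (forall x, A x -> exists y, G (x, y)).
  left; have /choice[f fG] : forall x, exists y, A x -> G (x, y).
    move=> x; have [/domG[y Gxy]|nAx] := pselect (A x); first by exists y.
    by exists x.
  exists f; split=> [x y /set_mem Ax /set_mem Ay fxy|_ [x Ax <-]].
    exact/(Ginj _ _ (fG _ Ax) (fG _ Ay)).
  by have [] := GAB _ (fG _ Ax).
have [ranG|/existsNP[y /not_implyP[By yG]]] :=
    pselect (forall y, B y -> exists x, G (x, y)).
  right; have /choice[f fG] : forall z, exists w, B z -> G (w, z).
    move=> z; have [/ranG[w Gwz]|nBz] := pselect (B z); first by exists w.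
    by exists z.
  exists f; split=> [x' y' /set_mem Bx' /set_mem By' fxy|_ [x' Bx' <-]].
    exact/(Ginj _ _ (fG _ Bx') (fG _ By')).
  by have [] := GAB _ (fG _ Bx').
case: (Gmax (G `|` [set (x, y)])) => [|].
  split; first by move=> u Gu; left.
  by move=> /(_ (x, y) (or_intror erefl)) Gxy; apply: xG; exists y.
split=> [u [/GAB//|->//]|u v [Gu|->] [Gv|->]//=]; first exact: Ginj.
  case: u Gu => u1 u2 Gu /=; split=> E; exfalso.
    by apply: xG; exists u2; rewrite -E.
  by apply: yG; exists u1; rewrite -E.
case: v Gv => u1 u2 Gu /=; split=> E; exfalso.
  by apply: xG; exists u2; rewrite E.
by apply: yG; exists u1; rewrite E.
Qed.

(** An injection of [D * D] into [D], kept as a set of triples so that chains of such injections can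
    be glued by union. The last clause says at once that the graph is single-valued and
    injective. *)
Definition square_graph (T : Type) (G : set (T * T * T)) (D : set T) :=
  [/\ forall u, G u -> [/\ D u.1.1, D u.1.2 & D u.2],
      forall x y, D x -> D y -> exists z, G (x, y, z) &
      forall u v, G u -> G v -> u.1 = v.1 <-> u.2 = v.2].

Lemma square_graphP (T : Type) (G : set (T * T * T)) D (t0 : T) :
  square_graph G D ->
  exists g : T -> T -> T, [/\ forall x y, D x -> D y -> D (g x y),
    forall x y, D x -> D y -> G (x, y, g x y) &
    forall x y x' y', D x -> D y -> D x' -> D y' ->
      g x y = g x' y' -> x = x' /\ y = y'].
Proof.
move=> [GD Gtot Ginj].
have /choice[g gG] : forall u : T * T, exists z, D u.1 -> D u.2 -> G (u, z).
  move=> [x y]; have [Dx|nDx] := pselect (D x); last by exists t0.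
  have [Dy|nDy] := pselect (D y); last by exists t0.
  by have [z Gz] := Gtot _ _ Dx Dy; exists z.
exists (fun x y => g (x, y)); split=> [x y Dx Dy|x y Dx Dy|].
- by have [] := GD _ (gG (x, y) Dx Dy).
- exact: gG.
- move=> x y x' y' Dx Dy Dx' Dy' E.
  by have /= [_ /(_ E)[]] := Ginj _ _ (gG (x, y) Dx Dy) (gG (x', y') Dx' Dy').
Qed.

(** A point of [E], the union of [D] and its copy under [f], is coded by a tag ([a] in [D], [b] in
    the copy) and by its representative in [D], so that [c] injects [E * E] into [D]. Pairs outside
    [D * D] are sent to the copy by [f] after [c], away from the values of [G]. *)
Lemma square_graph_extend (T : Type) (G : set (T * T * T)) (D : set T)
    (a b : T) (f : T -> T) :
  square_graph G D -> D a -> D b -> a <> b ->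
  {in D &, injective f} -> f @` D `<=` ~` D ->
  exists2 H, G `<` H & exists2 E, square_graph H E & D `<=` E.
Proof.
move=> GD Da Db ab finj fD.
have [g [gD gG ginj]] := square_graphP a GD; have [Gin Gtot Ginj] := GD.
pose E := D `|` f @` D.
have {}finj x y : D x -> D y -> f x = f y -> x = y.
  by move=> Dx Dy; apply: finj; rewrite inE.
have {}fD x : D x -> ~ D (f x) by move=> Dx; apply: fD; exists x.
have /choice[r rP] : forall x, exists y, E x -> D y /\ (x = y \/ x = f y).
  move=> x; have [[Dx|[y Dy yx]]|nEx] := pselect (E x).
  - by exists x => _; split=> //; left.
  - by exists y => _; split=> //; right.
  - by exists a.
pose t x := if pselect (D x) then a else b.
have tD x : D (t x) by rewrite /t; case: pselect.
have rD x : E x -> D (r x) by move=> /rP[].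
have rE x : E x -> x = if pselect (D x) then r x else f (r x).
  move=> /rP[Drx [|]]; case: pselect => // Dx xr.
    by case: Dx; rewrite xr.
  by case: (fD _ Drx); rewrite -xr.
have rt x y : E x -> E y -> t x = t y -> r x = r y -> x = y.
  move=> /rE + /rE; rewrite /t.
  case: pselect => Dx; case: pselect => Dy /= xE yE tE rxy.
  - by rewrite xE yE.
  - by case: ab.
  - by case: ab.
  - by rewrite xE yE rxy.
pose c x y := g (g (t x) (t y)) (g (r x) (r y)).
have cD x y : E x -> E y -> D (c x y).
  by move=> /rD Dx /rD Dy; apply: (gD) => //; apply: (gD).
have cinj x y x' y' : E x -> E y -> E x' -> E y' ->
    c x y = c x' y' -> x = x' /\ y = y'.
  move=> Ex Ey Ex' Ey' /ginj[]; try by apply: (gD); first [exact: tD|exact: rD].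
  move=> /ginj[]; try exact: tD.
  move=> tx ty /ginj[]; try exact: rD.
  by move=> rx ry; split; apply: rt.
pose H := G `|` [set u | [/\ E u.1.1, E u.1.2, ~ (D u.1.1 /\ D u.1.2) &
                            u.2 = f (c u.1.1 u.1.2)]].
have DE : D `<=` E by move=> x; left.
exists H.
  split=> [u Gu|HG]; first by left.
  (* The pair [(a, f a)] is outside [D * D], so its triple witnesses strictness. *)
  have /HG/Gin[_ /= /(fD _ Da)//] : H (a, f a, f (c a (f a))).
  right; split=> //=; first exact: DE.
    by right; exists a.
  by move=> [_]; exact: fD.
exists E => //; split=> [u [/Gin[? ? ?]|[? ? _ ->]]|x y Ex Ey|].
- by split; left.
- by split=> //; right; exists (c u.1.1 u.1.2) => //; exact: cD.
- have [[Dx Dy]|nD] := pselect (D x /\ D y).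
    by have [z Gz] := Gtot _ _ Dx Dy; exists z; left.
  by exists (f (c x y)); right; split.
- move=> u v [Gu|Hu] [Gv|Hv]; first exact: Ginj.
  + case: Hv => Ev1 Ev2 nDv v2; have [Du1 Du2 Du] := Gin _ Gu; split=> E0.
      by case: nDv; rewrite -E0.
    by case: (fD _ (cD _ _ Ev1 Ev2)); rewrite -v2 -E0.
  + case: Hu => Ev1 Ev2 nDv v2; have [Du1 Du2 Du] := Gin _ Gv; split=> E0.
      by case: nDv; rewrite E0.
    by case: (fD _ (cD _ _ Ev1 Ev2)); rewrite -v2 E0.
  + case: Hu Hv => [Eu1 Eu2 _ ->] [Ev1 Ev2 _ ->]; split=> [->//|].
    move=> /finj/cinj[]; try exact: cD; try by [].
    by case: (u.1) (v.1) => [? ?] [? ?] /= -> ->.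
Qed.

(** Take a maximal square graph whose domain [D] contains a countably infinite set. By
    [square_graph_extend] the complement of [D] contains no copy of [D], so it embeds into [D] by
    comparability; [T] then embeds into two disjoint copies of [D], which the pairing places inside
    [D]. *)
Lemma infinite_square (T : Type) : infinite_set [set: T] ->
  exists g : T -> T -> T, forall x y x' y', g x y = g x' y' -> x = x' /\ y = y'.
Proof.
move=> /infinite_inj[i inj_i].
pose D0 := range i.
have D0sq : square_graph
    [set u | exists n m, u = (i n, i m, i (pickle (n, m)))] D0.
  split=> [u [n [m ->]]|_ _ [n _ <-] [m _ <-]|u v [n [m ->]] [n' [m' ->]]] /=.
  - by split; eexists.
  - by exists (i (pickle (n, m))), n, m.
  - split=> [[/inj_i-> /inj_i->]//|].
    by move=> /inj_i/(pcan_inj pickleK) [-> ->].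
pose P G := G = set0 \/ exists2 D, square_graph G D & D0 `<=` D.
(* A square graph determines its domain through the diagonal, which gives the domain of a union of
   graphs. *)
have domE (G : set (T * T * T)) (D : set T) :
    square_graph G D -> D = [set x | exists z, G (x, x, z)].
  move=> [GD Gtot _]; apply/seteqP; split=> x; first by move=> Dx; exact: Gtot.
  by move=> [z /GD[]].
have [F FP totF|G [PG Gmax]] := @Zorn_bigcup _ P.
  have [F'0|] := pselect (forall G, F G -> G = set0).
    by left; rewrite -subset0 => u [G FG]; rewrite (F'0 G FG).
  move=> /existsNP[G0 /not_implyP[FG0 G00]]; right.
  set U := \bigcup_(X in F) X.
  have GP G : F G -> G !=set0 -> exists2 D, square_graph G D & D0 `<=` D.
    by move=> FG [u Gu]; case: (FP _ FG) => // G0'; rewrite G0' in Gu.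
  have tot u v : U u -> U v ->
      exists G D, [/\ F G, square_graph G D, D0 `<=` D, G u & G v].
    move=> [G FG Gu] [H FH Hv]; have [GH|HG] := totF _ _ FG FH.
      have [D ? ?] := GP _ FH (ex_intro _ _ Hv); exists H, D; split=> //.
      exact: GH.
    have [D ? ?] := GP _ FG (ex_intro _ _ Gu); exists G, D; split=> //.
    exact: HG.
  exists [set x | exists z, U (x, x, z)]; last first.
    move: G00 => /eqP/set0P /(GP _ FG0)[D sD D0D] x /D0D.
    by rewrite (domE _ _ sD) =>  -[z G0z]; exists z, G0.
  have DU G D : F G -> square_graph G D -> D `<=` [set x | exists z, U (x, x, z)].
    by move=> FG /domE -> x [z Gz]; exists z, G.
  split=> [u Uu|x y [z Uz] [w Uw]|u v Uu Uv].
  - have [G [D [FG sG _ Gu _]]] := tot _ _ Uu Uu.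
    have [GD _ _] := sG.
    by have [? ? ?] := GD _ Gu; split; apply: (DU _ _ FG sG).
  - have [G [D [FG [GD Gtot _] _ Gz Gw]]] := tot _ _ Uz Uw.
    have [Dx _ _] := GD _ Gz; have [Dy _ _] := GD _ Gw.
    by have [v Gv] := Gtot _ _ Dx Dy; exists v, G.
  - by have [G [D [FG [_ _ GI] _ Gu Gv]]] := tot _ _ Uu Uv; exact: GI.
have [D sG D0D] : exists2 D, square_graph G D & D0 `<=` D.
  case: PG => // G0; exfalso; apply: Gmax (or_intror (ex_intro2 _ _ _ D0sq _)) => //.
  rewrite G0; split=> [//|/(_ (i 0%N, i 0%N, i (pickle (0%N, 0%N))))].
  by apply; exists 0%N, 0%N.
have Di n : D (i n) by apply: D0D; exists n.
have i01 : i 0%N <> i 1%N by move=> /inj_i.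
have [f [finj fD]] : exists f : T -> T,
    {in ~` D &, injective f} /\ f @` (~` D) `<=` D.
  have [[f [finj fD]]|//] := set_inj_total D (~` D).
  have [H GH [E sH DE]] := square_graph_extend sG (Di 0%N) (Di 1%N) i01 finj fD.
  case: (Gmax H GH); right; exists E => //; exact: subset_trans DE.
have [g [gD _ ginj]] := square_graphP (i 0%N) sG.
pose h x := if pselect (D x) then g (i 0%N) x else g (i 1%N) (f x).
have fD' x : ~ D x -> D (f x) by move=> Dx; apply: fD; exists x.
have hD x : D (h x) by rewrite /h; case: pselect => Dx; apply: gD; auto.
have hinj : injective h.
  move=> x y; rewrite /h; case: pselect => Dx; case: pselect => Dy.
  - by move=> /ginj[].
  - by move=> /ginj[]; auto => /inj_i.
  - by move=> /ginj[]; auto => /inj_i.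
  - by move=> /ginj[]; auto => _; apply: finj; rewrite inE.
exists (fun x y => g (h x) (h y)) => x y x' y'.
by move=> /ginj[] // /hinj-> /hinj->.
Qed.

(** The length is stored beside the iterated pairing, whose values alone need not separate sequences
    of different lengths. *)
Lemma infinite_seq (T : Type) : infinite_set [set: T] ->
  exists c : seq T -> T, injective c.
Proof.
move=> Tinf; have [g ginj] := infinite_square Tinf.
have [i inj_i] := infinite_inj Tinf.
exists (fun s => g (i (size s)) (foldr g (i 0%N) s)) => s s'.
move=> /ginj[/inj_i]; elim: s s' => [|x s IHs] [|x' s']//= [/IHs ss'].
by move=> /ginj[-> /ss'->].
Qed.

(** This is [J * J = J] for [J = 2^(2^eta)]. A pair of families becomes a union of two tagged
    families: [j b D] consists of a copy of [D] and, if [b] holds, of a marker point outside of all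
    such copies. *)
Lemma infinite_power_square (T : Type) : infinite_set [set: T] ->
  exists c : set (set T) -> set (set T) -> set (set T),
    forall P Q P' Q', c P Q = c P' Q' -> P = P' /\ Q = Q'.
Proof.
move=> Tinf; have [g ginj] := infinite_square Tinf.
have [i inj_i] := infinite_inj Tinf.
pose j (b : bool) (D : set T) :=
  g (i 0%N) @` D `|` [set x | b /\ x = g (i 1%N) (i 0%N)].
have jinj b D b' D' : j b D = j b' D' -> b = b' /\ D = D'.
  move=> jE; have bE b0 D0 : j b0 D0 (g (i 1%N) (i 0%N)) <-> b0.
    by split=> [[[x _ /ginj[/inj_i]]|[]]//|b0T]; right.
  have DE b0 D0 x : j b0 D0 (g (i 0%N) x) <-> D0 x.
    split=> [[[y ? /ginj[_ <-]//]|[_ /ginj[/inj_i]]]//|D0x].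
    by left; exists x.
  split; last first.
    apply/seteqP; split=> x.
      by move=> /(DE b); rewrite jE => /DE.
    by move=> /(DE b'); rewrite -jE => /DE.
  apply/idP/idP.
    by move=> /(bE b D); rewrite jE => /bE.
  by move=> /(bE b' D'); rewrite -jE => /bE.
exists (fun P Q => j true @` P `|` j false @` Q) => P Q P' Q' cE.
have PE P0 Q0 D : (j true @` P0 `|` j false @` Q0) (j true D) <-> P0 D.
  split=> [[[D' ? /jinj[_ <-]//]|[D' _ /jinj[]//]]|P0D].
  by left; exists D.
have QE P0 Q0 D : (j true @` P0 `|` j false @` Q0) (j false D) <-> Q0 D.
  split=> [[[D' _ /jinj[]//]|[D' ? /jinj[_ <-]//]]|P0D].
  by right; exists D.
split; apply/seteqP; split=> D.
- by move=> /(PE _ Q); rewrite cE => /PE.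
- by move=> /(PE _ Q'); rewrite -cE => /PE.
- by move=> /(QE P); rewrite cE => /QE.
- by move=> /(QE P'); rewrite -cE => /QE.
Qed.

End Cardinals.

(** * Cofinal ultrafilters: how many there are, and how to separate them *)

Section CofinalUltrafilters.
Variables (d : Order.disp_t) (T : orderType d).
Hypothesis eta : infinite_initial_ordinal T.

Lemma cofinal_ultrafilter_tail (p : set_system T) (t : T) :
  cofinal_ultrafilter p -> p [set s | (t <= s)%O].
Proof.
move=> [pU pcof]; have [//|/pcof/(_ t)[s]] := in_ultra_setVsetC [set s | (t <= s)%O] pU.
by [].
Qed.

(* With c injecting triples (x, s, S) into T, the sets I_Y of the c (x, s, S)
   such that the part of s lying in Y belongs to S, for Y a subset of T, form
   an independent family; as x is arbitrary, its finite boolean combinations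
   have the cardinality of T, hence are cofinal. *)
Lemma cofinal_ultrafilters : exists p : set (set T) -> set_system T,
  (forall D, cofinal_ultrafilter (p D)) /\ injective p.
Proof.
have [Tinf _ Tinit] := eta.
have [c1 c1inj] := infinite_seq Tinf.
have [g ginj] := infinite_square Tinf.
have [i _] := infinite_inj Tinf; pose inh := i 0%N.
pose c x (s : seq T) (S : seq (seq T)) := g x (g (c1 s) (c1 (map c1 S))).
have cinj x s S x' s' S' : c x s S = c x' s' S' -> [/\ x = x', s = s' & S = S'].
  by move=> /ginj[-> /ginj[/c1inj-> /c1inj/(inj_map c1inj)->]].
pose tr (Y : set T) (s : seq T) := [seq x <- s | x \in Y].
pose I (Y : set T) := [set y | exists x s S, tr Y s \in S /\ y = c x s S].
have IE Y x s S : I Y (c x s S) <-> tr Y s \in S.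
  split=> [[x' [s' [S' [? /cinj[_ -> ->]//]]]]|?].
  by exists x, s, S.
pose base (D : set (set T)) (L : seq (set T)) (t : T) :=
  [set s | (t <= s)%O /\ forall Y, Y \in L -> I Y s <-> D Y].
(* [s] collects a point of the symmetric difference of each two distinct members of [L], so that
   their traces on [s] differ. *)
have sep (L : seq (set T)) : exists s : seq T,
    forall Y Z, Y \in L -> Z \in L -> tr Y s = tr Z s -> Y = Z.
  have /choice[w wP] : forall YZ : set T * set T, exists x : T,
      YZ.1 <> YZ.2 -> (x \in YZ.1) != (x \in YZ.2).
    move=> YZ; apply: contrapT => nx; have [YZ0] : YZ.1 <> YZ.2 /\ True.
      by split=> // YZ0; apply: nx; exists inh.
    case: YZ0; apply: contrapT => YZ0.
    have YZE x : YZ.1 x <-> YZ.2 x.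
      apply: contrapT => nYZx; apply: nx; exists x => _.
      apply/eqP => E; apply: nYZx; split=> /mem_set; [rewrite E|rewrite -E].
        by move=> /set_mem.
      by move=> /set_mem.
    by apply: YZ0; apply/seteqP; split=> x /YZE.
  exists [seq w (Y, Z) | Y <- L, Z <- L] => Y Z YL ZL trE.
  apply: contrapT => /(wP (Y, Z)) /= /negP; apply; apply/eqP.
  have ws : w (Y, Z) \in [seq w (Y, Z) | Y <- L, Z <- L].
    by apply/allpairsP; exists (Y, Z).
  have := mem_filter (fun x => x \in Y) (w (Y, Z)) [seq w (Y, Z) | Y <- L, Z <- L].
  rewrite -/(tr Y _) trE mem_filter ws !andbT => <-.
  by [].
have base0 D L t : base D L t !=set0.
  have [s sP] := sep L.
  (* With this [S], the points [c x s S] realize for every [x] the pattern that [D] prescribes on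
     [L]. *)
  pose S := [seq tr Y s | Y <- L & Y \in D].
  have Sx x Y : Y \in L -> I Y (c x s S) <-> D Y.
    move=> YL; rewrite IE; split=> [/mapP[Z]|DY]; last first.
      by apply/mapP; exists Y => //; rewrite mem_filter YL andbT inE.
    rewrite mem_filter => /andP[/set_mem DZ ZL] E.
    by rewrite (sP Y Z).
  (* If no such point were above [t], then [x |-> c x s S] would inject [T] into a proper initial
     segment. *)
  apply: contrapT => B0; apply: (Tinit t).
  apply: (@injective_card_le _ _ _ (fun x => c x s S)).
    by move=> x y /cinj[].
  move=> x /=; rewrite ltNge; apply/negP => tx; apply: B0.
  by exists (c x s S); split=> // Y; exact: Sx.
pose F D : set_system T := [set P | exists L t, base D L t `<=` P].
have FF D : ProperFilter (F D).
  split.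
    by move=> [L [t]]; have [x Bx] := base0 D L t; move=> /(_ x Bx).
  split.
  - by exists [::], inh.
  - move=> P Q [L1 [t1 BP]] [L2 [t2 BQ]].
    exists (L1 ++ L2), (Order.max t1 t2) => x [].
    rewrite ge_max => /andP[t1x t2x] xL; split.
      by apply: BP; split=> // Y YL; apply: xL; rewrite mem_cat YL.
    by apply: BQ; split=> // Y YL; apply: xL; rewrite mem_cat YL orbT.
  - by move=> P Q PQ [L [t BP]]; exists L, t; exact: subset_trans PQ.
have /choice[p pP] : forall D, exists p, UltraFilter p /\ F D `<=` p.
  by move=> D; exact: ultraFilterLemma.
exists p; split=> [D|D D' pE].
  have [pU Fp] := pP D; split=> // B pB t.
  have pt : p D (base D [::] t) by apply: Fp; exists [::], t.
  by have [s [Bs [ts _]]] := filter_ex (filterI pB pt); exists s.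
(* [D] is recovered from [p D] by testing the sets [I Y], whence injectivity. *)
have ID D0 Y : p D0 (I Y) <-> D0 Y.
  have [pU Fp] := pP D0.
  have : p D0 (base D0 [:: Y] inh) by apply: Fp; exists [:: Y], inh.
  move=> pB; split=> [pI|D0Y].
    have [s [Is [_ /(_ Y)]]] := filter_ex (filterI pI pB).
    by rewrite inE eqxx => /(_ isT) <-.
  apply: filterS pB => s [_ /(_ Y)]; rewrite inE eqxx => /(_ isT).
  by move=> ->.
by apply/seteqP; split=> Y /ID; [rewrite pE|rewrite -pE] => /ID.
Qed.

(** Distinct ultrafilters are incomparable, so for each [j] other than [i] some member of [p i] has
    its complement in [p j]; intersect these finitely many members. *)
Lemma separate_ultrafilters (I : finType) (p : I -> set_system T) (i : I) :
  (forall j, UltraFilter (p j)) -> injective p ->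
  exists2 P, p i P & forall j, j != i -> p j (~` P).
Proof.
move=> pU pinj.
have /choice[Q QP] : forall j, exists Q, p i Q /\ (j != i -> p j (~` Q)).
  move=> j; have [->|ji] := eqVneq j i; first by exists setT; split=> //; exact: filterT.
  apply: contrapT => nQ; move/eqP: ji; apply; apply: pinj.
  have ij Q : p i Q -> p j Q.
    move=> pQ; have [//|pjQ] := in_ultra_setVsetC Q (pU j).
    by case: nQ; exists Q.
  apply/seteqP; split=> Q; last exact: ij.
  move=> pQ; have [//|/ij pjQ] := in_ultra_setVsetC Q (pU i).
  by have [x []] := filter_ex (filterI pQ pjQ).
exists [set x | forall j, Q j x].
  by apply: filter_forall => j; have [] := QP j.
move=> j ji; have [_ /(_ ji)] := QP j; apply: filterS => x nQ /(_ j).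
exact: nQ.
Qed.

End CofinalUltrafilters.

(** * The Hahn-Banach theorem, first real and then complex *)

Section HahnBanach.
Variables (R : realType) (V : lmodType R[i]) (p : V -> R).
Hypothesis pD : forall x y, p (x + y) <= p x + p y.

(** Graphs of real-linear functionals on real subspaces, dominated by [p]. For homogeneous [p],
    domination makes such a graph single-valued. *)
Let subspace_graph (G : set (V * R)) :=
  [/\ G (0, 0),
      forall (r : R) u v, G u -> G v -> G (r%:C *: u.1 + v.1, r * u.2 + v.2) &
      forall u, G u -> u.2 <= p u.1].

Section OneStep.
Hypothesis pZ : forall (r : R) x, p (r%:C *: x) = `|r| * p x.

(** By subadditivity each [u.2 - p (u.1 - x0)] is at most each [p (v.1 + x0) - v.2]; the value [c]
    at [x0] is the supremum of the former. *)
Lemma subspace_graph_extend (G : set (V * R)) (x0 : V) : subspace_graph G ->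
  exists H c, [/\ subspace_graph H, G `<=` H & H (x0, c)].
Proof.
move=> [G0 Glin Gp].
pose L := [set u.2 - p (u.1 - x0) | u in G].
have Lub v : G v -> ubound L (p (v.1 + x0) - v.2).
  move=> Gv _ [u Gu <-]; rewrite lerBrDr addrAC lerBlDr.
  have := Gp _ (Glin 1 _ _ Gu Gv); rewrite /= scale1r mul1r => /le_trans; apply.
  apply: (le_trans _ (pD _ _)).
  by rewrite [u.1 - x0]addrC addrA addrK [v.1 + _]addrC.
have Lsup : has_sup L.
  split; first by exists (0 - p (0 - x0)), (0, 0).
  by exists (p (0 + x0) - 0); exact: (Lub (0, 0)).
pose c := sup L.
have cge u : G u -> u.2 - p (u.1 - x0) <= c.
  by move=> Gu; apply: (sup_upper_bound Lsup); exists u.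
have cle v : G v -> c <= p (v.1 + x0) - v.2.
  by move=> Gv; apply: ge_sup; [case: Lsup|exact: Lub].
have Gscale (r : R) u : G u -> G (r%:C *: u.1, r * u.2).
  by move=> Gu; have := Glin r _ _ Gu G0; rewrite /= !addr0.
exists [set w | exists u r, G u /\ w = (u.1 + r%:C *: x0, u.2 + r * c)], c.
split; last 2 first.
- move=> [u1 u2] Gu; exists (u1, u2), 0; split=> //=.
  by rewrite scale0r mul0r !addr0.
- by exists (0, 0), 1; rewrite /= scale1r mul1r !add0r.
split.
- by exists (0, 0), 0; rewrite /= scale0r mul0r !addr0.
- move=> r _ _ [u [s [Gu ->]]] [v [t [Gv ->]]].
  exists (r%:C *: u.1 + v.1, r * u.2 + v.2), (r * s + t); split; first exact: Glin.
  congr pair => /=.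
    by rewrite scalerDr rmorphD rmorphM scalerDl scalerA addrACA.
  by rewrite mulrDr mulrDl mulrA addrACA.
- move=> _ [u [r [Gu ->]]] /=.
  (* For nonzero [r], dividing by [|r|] reduces the claim to one of the two bounds on [c], according
     to the sign. *)
  have [r0|r0|->] := ltrgtP r 0; last first.
  + by rewrite scale0r mul0r !addr0; exact: Gp.
  + have := cle _ (Gscale r^-1 _ Gu); rewrite /= -(ler_pM2l r0) mulrBr mulrA.
    rewrite divff ?gt_eqF// mul1r lerBrDr addrC => /le_trans; apply.
    have -> : u.1 + r%:C *: x0 = r%:C *: (r^-1%:C *: u.1 + x0).
      by rewrite scalerDr scalerA -rmorphM divff ?gt_eqF// scale1r.
    by rewrite pZ gtr0_norm.
  + have rN0 : 0 < - r by rewrite oppr_gt0.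
    have := cge _ (Gscale (- r)^-1 _ Gu); rewrite /= -(ler_pM2l rN0) mulrBr mulrA.
    rewrite divff ?gt_eqF// mul1r [leRHS]mulNr lerBlDr [leRHS]addrC -lerBlDr opprK.
    move=> /le_trans; apply.
    have -> : u.1 + r%:C *: x0 = (- r)%:C *: ((- r)^-1%:C *: u.1 - x0).
      rewrite scalerBr scalerA -rmorphM divff ?gt_eqF// scale1r.
      by rewrite rmorphN scaleNr opprK.
    by rewrite pZ gtr0_norm.
Qed.

(** By one-step extension a maximal graph is defined everywhere. It is single-valued because the
    difference of two values at a point is a value at 0, hence at most [p 0 = 0]. *)
Lemma real_hahn_banach (G0 : set (V * R)) : subspace_graph G0 ->
  exists h : V -> R, [/\ forall (r : R) x y, h (r%:C *: x + y) = r * h x + h y,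
    forall x, h x <= p x & forall u, G0 u -> h u.1 = u.2].
Proof.
move=> G0s.
pose P G := G = set0 \/ subspace_graph G /\ G0 `<=` G.
have [F FP totF|G [PG Gmax]] := @Zorn_bigcup _ P.
  have [F'0|] := pselect (forall G, F G -> G = set0).
    by left; rewrite -subset0 => u [G FG]; rewrite (F'0 G FG).
  move=> /existsNP[G1 /not_implyP[FG1 /eqP/set0P[u1 Gu1]]]; right.
  set U := \bigcup_(X in F) X.
  have GP G u : F G -> G u -> subspace_graph G /\ G0 `<=` G.
    by move=> FG Gu; case: (FP _ FG) => // G0'; rewrite G0' in Gu.
  have G01 : G0 `<=` U by move=> u G0u; exists G1 => //; apply: (GP _ _ FG1 Gu1).2.
  split=> //; split.
  - by apply: G01; case: G0s.
  - move=> r u v [G FG Gu] [H FH Hv]; have [GH|HG] := totF _ _ FG FH.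
      exists H => //; have [[_ Hlin _] _] := GP _ _ FH Hv.
      by apply: Hlin => //; exact: GH.
    exists G => //; have [[_ Glin _] _] := GP _ _ FG Gu.
    by apply: Glin => //; exact: HG.
  - by move=> u [G FG Gu]; have [[_ _ Gp] _] := GP _ _ FG Gu; exact: Gp.
have [sG G0G] : subspace_graph G /\ G0 `<=` G.
  case: PG => // GE; exfalso; apply: (Gmax G0); last by right; split.
  by rewrite GE; split=> // /(_ (0, 0)); apply; case: G0s.
have /choice[h hG] : forall x, exists c, G (x, c).
  move=> x; have [H [c [sH GH Hc]]] := subspace_graph_extend x sG.
  exists c; apply: contrapT => nGc; apply: (Gmax H).
    by split=> // HG; apply/nGc/HG.
  by right; split=> //; exact: subset_trans GH.
have [_ Glin Gp] := sG.
have Gle x c c' : G (x, c) -> G (x, c') -> c <= c'.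
  move=> Gc Gc'; have := Gp _ (Glin (-1) _ _ Gc' Gc).
  rewrite /= rmorphN1 scaleN1r addNr mulN1r.
  have -> : p 0 = 0 by have := pZ 0 0; rewrite scaler0 normr0 mul0r.
  by rewrite addrC subr_le0.
have Gfun x c c' : G (x, c) -> G (x, c') -> c = c'.
  by move=> Gc Gc'; apply/le_anti; rewrite (Gle x)// (Gle x).
exists h; split=> [r x y|x|[x c] /G0G Gu].
- exact: Gfun (hG _) (Glin r _ _ (hG x) (hG y)).
- exact: Gp (hG x).
- exact: Gfun (hG _) Gu.
Qed.

End OneStep.

Hypothesis pZ : forall (k : R[i]) x, (p (k *: x))%:C = `|k| * (p x)%:C.

(** Domination on the span of the prescribed pairs, taken in the product space, makes the
    prescriptions consistent as well as bounded. Their real parts extend to [h], and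
    [h x - i h (i x)] is the complex-linear functional with real part [h]. *)
Lemma hahn_banach (G : set (V * R[i]^o)) :
  (forall u, Defs.span G u -> `|u.2| <= (p u.1)%:C) ->
  exists f : V -> R[i]^o, [/\ linear f, forall x, `|f x| <= (p x)%:C &
    forall u, G u -> f u.1 = u.2].
Proof.
move=> Gp.
have pZr (r : R) x : p (r%:C *: x) = `|r| * p x.
  apply: complexI; rewrite pZ rmorphM; congr (_ * _).
  by rewrite normc_def /= expr0n addr0 sqrtr_sqr.
have [|h [hlin hp hG]] := @real_hahn_banach pZr
    [set w | exists2 u, Defs.span G u & w = (u.1, complex.Re u.2)].
  split.
  - by exists 0 => //; exact: Defs.span0.
  - move=> r _ _ [u Gu ->] [v Gv ->]; exists (r%:C *: u + v); first exact: Defs.spanP.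
    congr pair => /=; case: (u.2) (v.2) => [a b] [a' b'] /=.
    by rewrite mul0r subr0.
  - move=> _ [u Gu ->] /=; rewrite -lecR (le_trans _ (Gp _ Gu))//.
    by rewrite (le_trans _ (normc_ge_Re _))// lecR ler_norm.
pose f x : R[i]^o := h x +i* - h ('i *: x).
have hD x y : h (x + y) = h x + h y.
  by have := hlin 1 x y; rewrite scale1r mul1r.
have hZ (r : R) x : h (r%:C *: x) = r * h x.
  have h0 : h 0 = 0 by apply: (@addIr _ (h 0)); rewrite -hD !addr0? add0r.
  by have := hlin r x 0; rewrite h0 !addr0.
have hN x : h (- x) = - h x by have := hZ (-1) x; rewrite rmorphN1 scaleN1r mulN1r.
have iE (k : R[i]) x : k *: x = (complex.Re k)%:C *: x + (complex.Im k)%:C *: ('i *: x).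
  by rewrite [k in LHS]complexE scalerDl scalerA mulrC.
have ii x : 'i *: ('i *: x) = - x :> V.
  by rewrite scalerA -expr2 sqr_i scaleN1r.
have flin : linear f.
  move=> k x y; rewrite /f.
  have -> : h (k *: x + y) = complex.Re k * h x + complex.Im k * h ('i *: x) + h y.
    by rewrite hD iE hD !hZ.
  have -> : h ('i *: (k *: x + y)) =
      complex.Re k * h ('i *: x) - complex.Im k * h x + h ('i *: y).
    rewrite scalerDr hD scalerA mulrC -scalerA iE hD !hZ ii hN.
    by rewrite mulrN.
  case: k => a b /=; apply/eqP; rewrite eq_complex /=; apply/andP; split; apply/eqP.
    by rewrite mulrN opprK.
  by rewrite mulrN !opprD opprK.
exists f; split=> [//|x|u Gu].
- have [fx0|fx0] := eqVneq (f x) 0.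
    rewrite fx0 normr0 ler0c.
    have : 0 <= (p x)%:C + (p (- x))%:C.
      rewrite -rmorphD ler0c (le_trans _ (pD _ _))// subrr.
      by have := pZr 0 0; rewrite scaler0 normr0 mul0r => ->.
    have := pZ (-1) x; rewrite scaleN1r normrN1 mul1r => ->.
    by rewrite -mulr2n pmulrn_lge0// ler0c.
  (* The unimodular factor [k] makes the value at [k *: x] equal to its modulus, so that the bound
     on the real part suffices. *)
  pose k := `|f x| / f x.
  have k1 : `|k| = 1 by rewrite normrM normr_id normfV divff// normr_eq0.
  have fk : f (k *: x) = `|f x|.
    have -> : f (k *: x) = k *: f x.
      have := flin k x 0; rewrite !addr0 => ->.
      have f0 : f 0 = 0 by rewrite /f scaler0 -[in X in h X](scaler0 _ 0) hZ mul0r oppr0.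
      by rewrite f0 addr0.
    by rewrite /k -[LHS]/(_ * _) divfK.
  have -> : (p x)%:C = (p (k *: x))%:C by rewrite pZ k1 mul1r.
  rewrite -fk -(ge0_Re (z := f (k *: x))) ?fk// -fk lecR; exact: hp.
- have Gu1 : Defs.span G u.
    exists 1%N, (fun=> 1), (fun=> u); split=> //.
    by rewrite big_ord1 scale1r.
  have Giu : Defs.span G ('i *: u).
    by have := Defs.spanP 'i Gu1 (Defs.span0 G); rewrite addr0.
  rewrite /f (hG (u.1, complex.Re u.2)); last by exists u.
  rewrite (hG ('i *: u.1, complex.Re ('i *: u.2))); last by exists ('i *: u).
  by case: (u.2) => a b /=; rewrite mul0r mul1r sub0r opprK.
Qed.

End HahnBanach.

(** * Linear maps given as plain functions *)

Section LinearMaps.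
Variables (K : numFieldType) (U W : lmodType K) (f : U -> W).
Hypothesis flin : linear f.

Lemma linear_map0 : f 0 = 0.
Proof. by have := flin (-1) 0 0; rewrite !scaleN1r !oppr0 addr0 addNr. Qed.

Lemma linear_mapD : {morph f : x y / x + y}.
Proof. by move=> x y; have := flin 1 x y; rewrite !scale1r. Qed.

Lemma linear_mapZ k : {morph f : x / k *: x}.
Proof. by move=> x; have := flin k x 0; rewrite !addr0 linear_map0 addr0. Qed.

Lemma linear_map_sum (I : Type) (r : seq I) (P : pred I) (x : I -> U) :
  f (\sum_(i <- r | P i) x i) = \sum_(i <- r | P i) f (x i).
Proof. exact: (big_morph f linear_mapD linear_map0). Qed.

End LinearMaps.

(** * Subspaces, bases and independent families *)

Section LinearIndependence.
Variables (K : numFieldType) (V : lmodType K).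
Implicit Types (E B L : set V).

Definition subspace L :=
  L 0 /\ forall (k : K) u v, L u -> L v -> L (k *: u + v).

Lemma subspaceD L u v : subspace L -> L u -> L v -> L (u + v).
Proof. by move=> [_ LP] Lu Lv; rewrite -[u]scale1r; exact: LP. Qed.

Lemma subspaceZ L k u : subspace L -> L u -> L (k *: u).
Proof. by move=> [L0 LP] Lu; rewrite -[_ *: _]addr0; exact: LP. Qed.

Lemma subspace_sum (I : Type) (r : seq I) (P : pred I) (u : I -> V) L :
  subspace L -> (forall i, P i -> L (u i)) -> L (\sum_(i <- r | P i) u i).
Proof.
by move=> sL Lu; apply: big_ind => //; [case: sL|move=> *; exact: subspaceD].
Qed.

Lemma subspace_span E : subspace (Defs.span E).
Proof. by split=> [|k u v]; [exact: Defs.span0|exact: Defs.spanP]. Qed.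

Lemma sub_span E : E `<=` Defs.span E.
Proof.
move=> x Ex; exists 1%N, (fun=> 1), (fun=> x); split=> //.
by rewrite big_ord1 scale1r.
Qed.

Lemma span_sub E L : subspace L -> E `<=` L -> Defs.span E `<=` L.
Proof.
move=> sL EL _ [n [z [x [Ex ->]]]]; apply: subspace_sum => // i _.
by apply: subspaceZ => //; exact: EL.
Qed.

Lemma lin_indep_fin E (I : finType) (P : pred I) (z : I -> K) (x : I -> V) :
  lin_indep E -> (forall i, P i -> E (x i)) -> {in P &, injective x} ->
  \sum_(i | P i) z i *: x i = 0 -> forall i, P i -> z i = 0.
Proof.
move=> indE Ex xinj; rewrite (big_enum_val (A := P)) /= => sum0 i Pi.
have ix : i \in P by [].
rewrite -(enum_rankK_in ix ix).
apply: (indE _ (fun k : 'I_#|P| => z (enum_val k)) (fun k => x (enum_val k))) => //.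
  by move=> k; apply: Ex; exact: (enum_valP k).
move=> k l kl; apply: enum_val_inj.
exact: (xinj _ _ (enum_valP k) (enum_valP l) kl).
Qed.

Lemma lin_indep_add E v : lin_indep E -> ~ Defs.span E v ->
  lin_indep (E `|` [set v]).
Proof.
move=> indE nEv n z x Ex xinj sum0.
have [[i xi]|nv] := pselect (exists i, x i = v); last first.
  apply: (indE n z x) => // i; have [//|xi] := Ex i.
  by case: nv; exists i.
have Exj j : j != i -> E (x j).
  move=> /eqP ji; have [//|] := Ex j; rewrite /= -xi => /xinj.
  by [].
have zi : z i = 0.
  apply: contrapT => /eqP zi; apply: nEv.
  move: sum0; rewrite (bigD1 i)//= xi => /eqP; rewrite addr_eq0 => /eqP.
  move=> /(congr1 (fun u => (z i)^-1 *: u)); rewrite scalerA mulVf// scale1r => ->.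
  have sE := subspace_span E.
  rewrite -scaleN1r scalerA; apply: subspaceZ => //.
  apply: subspace_sum => // j ji; apply: subspaceZ => //.
  exact/sub_span/Exj.
move=> j; have [->//|ji] := eqVneq j i.
apply: (@lin_indep_fin E _ (fun j => j != i) z x) => //.
  by move=> ? ? _ _; exact: xinj.
by move: sum0; rewrite (bigD1 i)//= zi scale0r add0r.
Qed.

(** Zorn's lemma is applied to the part [B] added to [E], so that the empty chain corresponds to [E]
    itself. *)
Lemma extend_basis L E : subspace L -> E `<=` L -> lin_indep E ->
  exists2 B, basis_of_set L B & E `<=` B.
Proof.
move=> sL EL indE.
pose P B := lin_indep (E `|` B) /\ B `<=` L.
have [F FP totF|B [[indB BL] Bmax]] := @Zorn_bigcup _ P.
  split; last by move=> x [X FX Xx]; exact: (FP _ FX).2.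
  (* Finitely many vectors involve a single member of the chain; the first alternative covers the
     empty chain. *)
  have chain (s : seq V) : {in s, forall x, (E `|` \bigcup_(X in F) X) x} ->
      {in s, forall x, E x} \/ exists2 X, F X & {in s, forall x, (E `|` X) x}.
    elim: s => [|x s IHs] sU; first by left.
    have {IHs} IHs : {in s, forall x, E x} \/
        exists2 X, F X & {in s, forall x, (E `|` X) x}.
      by apply: IHs => y ys; apply: sU; rewrite inE ys orbT.
    have [Ex|[X FX Xx]] := sU x (mem_head _ _).
      case: IHs => [sE|[X FX sX]]; [left|right; exists X => //].
        by move=> y; rewrite inE => /predU1P[->//|/sE].
      by move=> y; rewrite inE => /predU1P[->|/sX//]; left.
    right; case: IHs => [sE|[Y FY sY]].
      exists X => // y; rewrite inE => /predU1P[->|/sE]; by [right|left].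
    have [XY|YX] := totF _ _ FX FY.
      exists Y => // y; rewrite inE => /predU1P[->|/sY//].
      by right; exact: XY.
    exists X => // y; rewrite inE => /predU1P[->|/sY[]]; [by right|by left|].
    by move=> /YX; right.
  move=> n z x xU xinj sum0.
  have [y /mapP[i _ ->]||[X FX xX]] := chain [seq x i | i <- enum 'I_n].
  - exact: xU.
  - move=> xE; apply: (indE n z x) => // i.
    by apply: xE; apply/mapP; exists i => //; rewrite mem_enum.
  - apply: ((FP _ FX).1 n z x) => // i.
    by apply: xX; apply/mapP; exists i => //; rewrite mem_enum.
exists (E `|` B); last by move=> x; left.
have EBL : E `|` B `<=` L by move=> x [/EL|/BL].
split=> //; apply/seteqP; split; first exact: span_sub.
move=> v Lv; apply: contrapT => nv.
apply: (Bmax (B `|` [set v])).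
  split=> [x|/(_ v)]; first by left.
  move=> /(_ (or_intror erefl)) Bv; apply: nv.
  by apply: sub_span; right.
split; last by move=> x [/BL|->].
by rewrite setUA; exact: lin_indep_add.
Qed.

Section Families.
Variable J : Type.

(** Independence of a family excludes repetitions, unlike independence of the set of its values. *)
Definition indep_family (b : J -> V) :=
  forall n (z : 'I_n -> K) (x : 'I_n -> J), injective x ->
    \sum_(i < n) z i *: b (x i) = 0 -> forall i, z i = 0.

Lemma indep_family_fin (b : J -> V) (I : finType) (z : I -> K) (x : I -> J) :
  indep_family b -> injective x -> \sum_i z i *: b (x i) = 0 ->
  forall i, z i = 0.
Proof.
move=> indb xinj; rewrite (big_enum_val (A := I)) /= => sum0 i.
rewrite -(enum_rankK i).
apply: (indb _ (fun k : 'I_#|I| => z (enum_val k)) (fun k => x (enum_val k))) => //.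
by move=> k l /xinj; exact: enum_val_inj.
Qed.

Lemma indep_family_neq0 b j : indep_family b -> b j <> 0.
Proof.
move=> indb bj0; have /eqP := oner_neq0 K; apply.
apply: (indb 1%N (fun=> 1) (fun=> j) _ _ ord0); first by move=> ? ? _; rewrite !ord1.
by rewrite big_ord1 bj0 scaler0.
Qed.

Lemma indep_family_inj b : indep_family b -> injective b.
Proof.
move=> indb x y bxy; apply: contrapT => xy; have /eqP := oner_neq0 K; apply.
pose z (i : bool) : K := if i then 1 else -1.
have -> : 1 = z true by [].
apply: (@indep_family_fin b _ z (fun i => if i then x else y)) => //.
  by move=> [] [] //= /esym.
by rewrite big_bool /= bxy scaleN1r scale1r subrr.
Qed.

Lemma lin_indep_range b : indep_family b -> lin_indep (range b).
Proof.
move=> indb n z x /= xb xinj.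
have /choice[y yx] : forall i, exists y, b y = x i.
  by move=> i; have [y _ <-] := xb i; exists y.
under eq_bigr do rewrite -yx; apply: indb => i j yij; apply: xinj.
by rewrite -!yx yij.
Qed.

Variables (pair : J -> J -> J).
Hypothesis pair_inj : forall i j k l, pair i j = pair k l -> i = k /\ j = l.

(* Split the family into J-many families indexed by J: if the images of none
   of them are independent, the corresponding relations provide J-many vectors
   of the kernel with disjoint supports. *)
Lemma image_or_kernel (L : set V) (f : V -> V) (b : J -> V) :
  subspace L -> linear f -> indep_family b -> (forall j, L (b j)) ->
  (exists2 b', (forall j, L (b' j)) & indep_family (f \o b')) \/
  (exists2 b', indep_family b' & forall j, L (b' j) /\ f (b' j) = 0).
Proof.
move=> sL flin indb Lb.
have [[i indi]|ndep] :=
    pselect (exists i, indep_family (f \o (fun j => b (pair i j)))).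
  by left; exists (fun j => b (pair i j)) => // j; exact: Lb.
right.
have /choice[u uP] : forall i, exists u : {n & ('I_n -> K) * ('I_n -> J)}%type,
    [/\ injective (projT2 u).2,
        \sum_k (projT2 u).1 k *: f (b (pair i ((projT2 u).2 k))) = 0 &
        exists k, (projT2 u).1 k != 0].
  move=> i; have /existsNP[n /existsNP[z /existsNP[x]]] :
      ~ indep_family (f \o (fun j => b (pair i j))).
    by move=> indi; apply: ndep; exists i.
  move=> /not_implyP[xinj /not_implyP[sum0 /existsNP[k /eqP zk]]].
  by exists (existT _ n (z, x)); split=> //; exists k.
pose v i := \sum_k (projT2 (u i)).1 k *: b (pair i ((projT2 (u i)).2 k)).
exists v => [n z x xinj|i]; last first.
  split.
    by apply: subspace_sum => // k _; apply: subspaceZ => //; exact: Lb.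
  rewrite /v (linear_map_sum flin); under eq_bigr do rewrite (linear_mapZ flin).
  by have [] := uP i.
rewrite /v; under eq_bigr do rewrite scaler_sumr.
rewrite sig_big_dep /= => sum0 i.
have [_ _ [k /negPf zk]] := uP (x i).
(* Expanding the vectors [v (x i)] gives a relation among members of [b], indexed by dependent
   pairs; a nonzero coefficient in the relation chosen for [x i] then forces [z i = 0]. *)
pose Z (w : {i : 'I_n & 'I_(projT1 (u (x i)))}) : K :=
  z (tag w) * (projT2 (u (x (tag w)))).1 (tagged w).
have /eqP : Z (Tagged _ k) = 0.
  apply: (@indep_family_fin b _ Z (fun w =>
      pair (x (tag w)) ((projT2 (u (x (tag w)))).2 (tagged w)))) => //.
    move=> [i1 k1] [i2 k2] /= /pair_inj[/xinj i12].
    case: _ / i12 k2 => k2 xk; have [xinj' _ _] := uP (x i1).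
    by rewrite (xinj' _ _ xk).
  by rewrite -[RHS]sum0; apply: eq_bigr => w _; rewrite scalerA.
by rewrite /Z /= mulf_eq0 zk orbF => /eqP.
Qed.

(** The maps are treated one after the other: as long as no image is independent, [image_or_kernel]
    yields a [J]-indexed independent family in the common kernel of the maps treated so far. After
    the last map this family would consist of zeros. *)
Lemma joint_image (m : nat) (L : set V) (f : 'I_m -> V -> V) (b : J -> V) (j0 : J) :
  subspace L -> (forall k, linear (f k)) ->
  (forall x, L x -> (forall k, f k x = 0) -> x = 0) ->
  indep_family b -> (forall j, L (b j)) ->
  exists k, exists2 b', (forall j, L (b' j)) & indep_family (f k \o b').
Proof.
move=> sL flin fker indb Lb; apply: contrapT => nk.
have [b' indb' b'0] : exists2 b', indep_family b' &
    forall j, L (b' j) /\ {in enum 'I_m, forall k, f k (b' j) = 0}.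
  elim: (enum 'I_m) => [|k s [b' indb' b'0]]; first by exists b.
  pose Ls := [set x | L x /\ {in s, forall k, f k x = 0}].
  have sLs : subspace Ls.
    split; first by split=> [|l _]; [case: sL|exact: linear_map0 (flin l)].
    move=> a x y [Lx x0] [Ly y0]; split; first by case: sL => _; exact.
    by move=> l ls; rewrite flin x0// y0// scaler0 addr0.
  have [[b1 Lb1 indb1]|[b1 indb1 b10]] := image_or_kernel sLs (flin k) indb' b'0.
    by case: nk; exists k, b1 => // j; case: (Lb1 j).
  exists b1 => // j; have [[Lb1 b1s] fk0] := b10 j; split=> // l.
  by rewrite inE => /predU1P[->//|/b1s].
apply: (indep_family_neq0 indb' (j := j0)); have [Lb' b'0'] := b'0 j0.
by apply: fker => // k; apply: b'0'; rewrite mem_enum.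
Qed.

End Families.
End LinearIndependence.

(** * Left ideals generated by a separating family *)

Section LeftIdealsOfProducts.
Variables (K : numFieldType) (V : lmodType K) (mul : V -> V -> V).
Hypothesis mul_linear : forall z, linear (mul^~ z).
Variables (J : Type) (j0 : J) (pair : J -> J -> J).
Hypothesis pair_inj : forall i j k l, pair i j = pair k l -> i = k /\ j = l.
Variables (m : nat) (psi : J -> 'I_m -> V) (kappa : J -> 'I_m).
Hypothesis psi_disjoint : forall i j k l x y, i <> j ->
  mul x (psi i k) = mul y (psi j l) -> mul x (psi i k) = 0.
Hypothesis psi_separating : forall i x,
  (forall k, mul x (psi i k) = 0) -> x = 0.
Hypothesis psi_indep : indep_family (fun j => psi j (kappa j)).

(** The component [k j] is chosen so that the ideal of [psi j (k j)] is nonzero and, in a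
    subalgebra, contains a [J]-indexed independent family. Ideals of distinct indices meet at most
    in 0; being nonzero, they are distinct. *)
Lemma many_left_ideals (disj : Prop) (S : set V) :
  (forall j k, S (psi j k)) -> subsemigroup mul S \/ subalgebra mul S ->
  many_principal_left_ideals mul J disj S.
Proof.
move=> Spsi SS.
have Smul x y : S x -> S y -> S (mul x y).
  by case: SS => [[_]|[_ _]]; exact.
have mul0 z : mul 0 z = 0 by exact: linear_map0 (mul_linear z).
have /choice[k kP] : forall j, exists k,
    (exists2 x, S x & mul x (psi j k) <> 0) /\
    (subalgebra mul S -> exists2 b : J -> V, (forall i, S (b i)) &
       indep_family (fun i => mul (b i) (psi j k))).
  move=> j; have [[S0 SP _]|nSalg] := pselect (subalgebra mul S); last first.
    (* For a mere semigroup, one fixed nonzero element of [S] has a nonzero product with some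
       [psi j k]. *)
    have : exists k, mul (psi j0 (kappa j0)) (psi j k) <> 0.
      apply: contrapT => nk; apply: (indep_family_neq0 psi_indep (j := j0)) => /=.
      apply: (psi_separating (i := j)) => k; apply: contrapT => nk'.
      by apply: nk; exists k.
    by move=> [k psik]; exists k; split=> //; exists (psi j0 (kappa j0)).
  have [k [b Sb indb]] := joint_image pair_inj j0 (conj S0 SP)
    (fun k => mul_linear (psi j k)) (fun x _ => @psi_separating j x)
    psi_indep (fun j => Spsi j (kappa j)).
  exists k; split=> [|_]; last by exists b.
  by exists (b j0) => //; exact: (indep_family_neq0 indb (j := j0)).
pose L j := [set mul s (psi j (k j)) | s in S].
have L0 i j x : i <> j -> L i x -> L j x -> x = 0.
  by move=> ij [s Ss <-] [t St ts]; exact: (psi_disjoint ij (esym ts)).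
have Linj : injective L.
  move=> i j Lij; apply: contrapT => ij; have [[x Sx x0] _] := kP i.
  apply: x0; apply: (L0 _ _ _ ij); first by exists x.
  by rewrite -Lij; exists x.
exists (range L); split.
- by apply: injective_card_le Linj _ => j; exists j.
- by move=> _ [j _ <-]; exists (psi j (k j)).
- move=> _; split.
    move=> nS0 _ _ [i _ <-] [j _ <-] [x [Lix Ljx]].
    congr L; apply: contrapT => ij; apply: nS0.
    by have <- := L0 _ _ _ ij Lix Ljx; have [s Ss <-] := Lix; exact: Smul.
  move=> _ _ [i _ <-] [j _ <-] [x [[Lix x0] [Ljx _]]].
  congr L; apply: contrapT => ij; apply: x0.
  exact: L0 ij Lix Ljx.
- move=> _ [S0 _ _] _ _ [i _ <-] [j _ <-] Lij; apply/seteqP; split=> x.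
    by move=> [Lix Ljx]; apply: L0 Lix Ljx => ij; apply: Lij; rewrite ij.
  by move=> ->; split; exists 0.
- move=> Salg _ [j _ <-]; have [_ /(_ Salg)[b Sb indb]] := kP j.
  have [S0 SP _] := Salg.
  have sL : subspace (L j).
    split; first by exists 0.
    move=> a _ _ [s Ss <-] [t St <-]; exists (a *: s + t); first exact: SP.
    exact: mul_linear.
  have [|B BL EB] := extend_basis sL _ (lin_indep_range indb).
    by move=> _ [i _ <-]; exists (b i).
  exists B => //; apply: injective_card_le (indep_family_inj indb) _ => i.
  by apply: EB; exists i.
Qed.

End LeftIdealsOfProducts.

(** * Bounded functionals: extension, separation and density *)

Section NormedSpaces.
Variables (R : realType) (V : normedModType R[i]).

Lemma bounded_setP (B : set V) : bounded_set B ->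
  exists2 M : R[i], 0 <= M & forall x, B x -> `|x| <= M.
Proof.
move=> [M [Mreal MB]]; exists (`|M| + 1); first by rewrite addr_ge0.
move=> x Bx; apply: MB Bx; rewrite (le_lt_trans (real_ler_norm Mreal))//.
by rewrite ltrDl.
Qed.

Lemma ler_normM_bound (W : normedModType R[i]) (f : V -> W) (M : R[i]) :
  (forall x, `|f x| <= M * `|x|) -> forall x, `|f x| <= `|M| * `|x|.
Proof.
move=> fM x; rewrite (le_trans (fM x))//.
have <- : `|M * `|x| | = M * `|x| by rewrite ger0_norm// (le_trans _ (fM x)).
by rewrite normrM normr_id.
Qed.

Lemma dual_extension (G : set (V * R[i]^o)) (C : R[i]) : 0 <= C ->
  (forall u, Defs.span G u -> `|u.2| <= C * `|u.1|) ->
  exists f : dual V, forall u, G u -> f u.1 = u.2.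
Proof.
(* Norms take values in [R[i]], while [hahn_banach] expects a real-valued [p]. *)
move=> C0 GC; pose p (x : V) := complex.Re (C * `|x|).
have pE x : (p x)%:C = C * `|x| by apply: ge0_Re; rewrite mulr_ge0.
have [|||f [flin fp fG]] := @hahn_banach R V p _ _ G.
- by move=> x y; rewrite -lecR rmorphD /= !pE -mulrDr ler_wpM2l// ler_normD.
- by move=> k x; rewrite !pE normrZ mulrCA.
- by move=> u Gu; rewrite pE; exact: GC.
have fb : exists M : R[i], forall x, `|f x| <= M * `|x|.
  by exists C => x; rewrite -pE.
by exists (mk_dual flin fb).
Qed.

Lemma dual_separates (x : V) : x != 0 -> exists f : dual V, f x != 0.
Proof.
move=> x0; have nx0 : `|x| != 0 by rewrite normr_eq0.
have [|f fx] := @dual_extension [set (x, `|x| : R[i]^o)] 1 ler01.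
  pose L := [set u : V * R[i]^o | u.2 *: x = `|x| *: u.1].
  have sL : subspace L.
    split; first by rewrite /L /= scale0r scaler0.
    move=> k u v /= Lu Lv; rewrite /L /= scalerDl scalerDr -scalerA Lu Lv.
    by rewrite !scalerA mulrC.
  move=> u /(span_sub sL) Lu; have {Lu} : L u by apply: Lu => _ ->.
  move=> /(congr1 (fun y => `|y|)); rewrite !normrZ normr_id mulrC mul1r.
  by move=> /(mulfI nx0) ->.
by exists f; rewrite (fx (x, `|x|)).
Qed.

Lemma dual_eq_dense (E : set V) (f g : dual V) :
  closure (Defs.span E) = setT -> (forall x, E x -> f x = g x) -> f = g.
Proof.
move=> clE fg; apply: dualP => x; apply/eqP; rewrite -subr_eq0.
rewrite -normr_le0; apply/ler_addgt0Pl => e e0; rewrite addr0.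
have [h hE] : exists h : dual V, forall y, h y = f y - g y by exists (f - g).
have sL : subspace [set y | h y = 0].
  split; first exact: linear0.
  move=> k u v /= hu hv.
  have -> : h (k *: u + v) = k *: h u + h v by exact: linearP.
  by rewrite hu hv scaler0 addr0.
have h1 : 0 < `|h| + 1 by rewrite ltr_wpDl.
have : closure (Defs.span E) x by rewrite clE.
move=> /(_ _ (nbhsx_ballx x (e / (`|h| + 1)) _)) [|y [Ey]].
  by rewrite divr_gt0.
rewrite -ball_normE /= => xy.
have hy : h y = 0.
  by apply: (span_sub sL _ Ey) => z /fg; rewrite /= hE => ->; rewrite subrr.
rewrite -hE -[h x]subr0 -hy -linearB (le_trans (ler_dual _ _))//.
rewrite (le_trans (ler_wpM2l _ (ltW xy)))// mulrCA ler_piMr ?(ltW e0)//.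
by rewrite ler_pdivrMr// mul1r lerDl.
Qed.

End NormedSpaces.

Section Grouping.
Variables (K : numFieldType) (V : lmodType K) (T : choiceType).

(** Grouping the terms by index makes the indices distinct, as the inequalities defining the bases
    require. *)
Lemma span_bigcup (L : T -> set V) v : Defs.span (\bigcup_t L t) v ->
  exists s y, [/\ uniq s, forall t, Defs.span (L t) (y t) &
    v = \sum_(t <- s) y t].
Proof.
move=> [n [z [x [Lx ->]]]].
have /choice[t tL] : forall i, exists t, L t (x i).
  by move=> i; have [t _ Lt] := Lx i; exists t.
exists (undup [seq t i | i <- enum 'I_n]).
exists (fun u => \sum_(i < n | t i == u) z i *: x i); split.
- exact: undup_uniq.
- move=> u; apply: subspace_sum; first exact: subspace_span.
  move=> i /eqP <-; apply: subspaceZ; first exact: subspace_span.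
  exact/sub_span/tL.
- rewrite (exchange_big_dep predT)//=; apply: eq_bigr => i _.
  rewrite -big_filter.
  have -> : [seq u <- undup [seq t i | i <- enum 'I_n] | t i == u] = [:: t i].
    rewrite (eq_filter (a2 := pred1 (t i))); last by move=> u /=; rewrite eq_sym.
    rewrite filter_pred1_uniq ?undup_uniq// mem_undup.
    by apply/mapP; exists i; rewrite ?mem_enum.
  by rewrite big_seq1.
Qed.

End Grouping.

(** * Limits of bounded functions along ultrafilters *)

Section UltrafilterLimits.
Variable R : realType.

Lemma cvg_comb (J : Type) (G : set_system J) (GG : ProperFilter G)
    (h h' : J -> R[i]^o) (l l' : R[i]^o) (k : R[i]) :
  h @ G --> l -> h' @ G --> l' -> k *: h j + h' j @[j --> G] --> k *: l + l'.
Proof.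
move=> hl hl'; apply/cvgrPdist_lt => d d0.
have k0 : 0 < `|k| + 1 by rewrite ltr_wpDl.
have /cvgrPdist_lt/(_ (d / 2 / (`|k| + 1)) ltac:(by rewrite !divr_gt0)) hd := hl.
have /cvgrPdist_lt/(_ (d / 2) ltac:(by rewrite divr_gt0)) hd' := hl'.
apply: filterS2 hd hd' => j ld ld'.
have -> : k *: l + l' - (k *: h j + h' j) = k *: (l - h j) + (l' - h' j).
  by rewrite scalerBr opprD addrACA.
rewrite (le_lt_trans (ler_normD _ _))// [d]splitr ler_ltD//.
rewrite normrZ (@le_trans _ _ ((`|k| + 1) * `|l - h j|))//.
  by rewrite ler_wpM2r// lerDl.
by rewrite mulrC -ler_pdivlMr// ltW.
Qed.

Lemma ultra_fmap (J J' : Type) (f : J -> J') (U : set_system J) :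
  UltraFilter U -> UltraFilter (f @ U).
Proof.
move=> UU; split; first exact: fmap_proper_filter.
move=> G GF UG; apply/seteqP; split=> [A GA|]; last exact: UG.
have [//|nfA] := in_ultra_setVsetC (f @^-1` A) UU.
have GnA : G (~` A) by exact: UG.
by have [x []] := filter_ex (filterI GA GnA).
Qed.

Lemma ultra_cvg_real (J : Type) (U : set_system J) (h : J -> R) (M : R) :
  UltraFilter U -> (forall j, `|h j| <= M) -> exists l : R, h @ U --> l.
Proof.
move=> UU hM; have := @segment_compact R (- M) M.
rewrite compact_ultra => /(_ (h @ U) (ultra_fmap h UU)) [].
  by apply: (@filterE _ U) => j; rewrite /= in_itv /= -ler_norml.
by move=> l [_ hl]; exists l.
Qed.

(** Real and imaginary parts stay in a compact segment, where ultrafilters converge. *)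
Lemma ultra_cvg (J : Type) (U : set_system J) (h : J -> R[i]^o) (M : R[i]) :
  UltraFilter U -> (forall j, `|h j| <= M) -> exists l : R[i]^o, h @ U --> l.
Proof.
move=> UU hM.
have reM (z : R[i]) : `|z| <= M -> `|complex.Re z| <= complex.Re M /\
    `|complex.Im z| <= complex.Re M.
  move=> zM; have M0 : 0 <= M by rewrite (le_trans _ zM).
  split; rewrite -lecR ge0_Re// (le_trans _ zM)//; first exact: normc_ge_Re.
  have -> : complex.Im z = - complex.Re (z * 'i) by rewrite ReiNIm opprK.
  rewrite normrN (le_trans (normc_ge_Re _))// normrM [`|'i|]normc_def /=.
  by rewrite expr0n expr1n add0r sqrtr1 mulr1.
have [a ha] := @ultra_cvg_real _ U (fun j => complex.Re (h j)) _ UU (fun j => (reM _ (hM j)).1).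
have [b hb] := @ultra_cvg_real _ U (fun j => complex.Im (h j)) _ UU (fun j => (reM _ (hM j)).2).
exists (a +i* b); apply/cvgrPdist_lt => e e0.
have e2 : 0 < complex.Re e / 2.
  by rewrite divr_gt0// -ltcR ge0_Re// ltW.
have /cvgrPdist_lt/(_ _ e2) na := ha.
have /cvgrPdist_lt/(_ _ e2) nb := hb.
near=> j.
have -> : (a +i* b : R[i]^o) - h j =
    (a - complex.Re (h j))%:C + 'i%C * (b - complex.Im (h j))%:C.
  rewrite [h j in LHS]complexE; apply/eqP; rewrite eq_complex /=.
  by rewrite !(mul0r, mul1r, mulr0, subr0, addr0, add0r, mulr1) !eqxx.
rewrite (le_lt_trans (ler_normD _ _))// normrM.
have -> : `|'i%C : R[i]| = 1.
  by rewrite normc_def /= expr0n expr1n add0r sqrtr1.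
rewrite mul1r !normc_def /= !expr0n !addr0 !sqrtr_sqr -rmorphD.
rewrite -(ge0_Re (ltW e0)) ltcR [ltRHS]splitr ltrD//.
  by near: j.
by near: j.
Unshelve. all: by end_near. Qed.

End UltrafilterLimits.

(** * Multipliers as functionals on LUC(A), and their cluster points *)

Section ClusterPoints.
Variables (R : realType) (A : banachAlgType R[i]).

Lemma luc_separates (Phi : dual (luc A)) :
  (forall S b, Phi (lucact S b) = 0) -> Phi = 0.
Proof.
move=> Phi0; apply: dualP => f; rewrite [RHS]/=.
apply/eqP; rewrite -normr_le0; apply/ler_addgt0Pl => e e0; rewrite addr0.
have h1 : 0 < `|Phi| + 1 by rewrite ltr_wpDl.
have /luc_predP/(_ (e / (`|Phi| + 1)) ltac:(by rewrite divr_gt0))[g sg fg] := lucP f.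
have [g' g'E Phig'] : exists2 g' : luc A, luc_val g' = g & Phi g' = 0.
  pose L := [set h : dual A | exists2 g' : luc A, luc_val g' = h & Phi g' = 0].
  have sL : subspace L.
    split; first by exists 0 => //; exact: linear0.
    move=> k _ _ [u <- u0] [v <- v0]; exists (k *: u + v) => //.
    have -> : Phi (k *: u + v) = k *: Phi u + Phi v by exact: linearP.
    by rewrite u0 v0 scaler0 addr0.
  by apply: (span_sub sL _ sg) => _ [S _ [b _ <-]]; exists (lucact S b).
rewrite -[Phi f]subr0 -Phig' -linearB (le_trans (ler_dual _ _))//.
have fg' : `|f - g'| <= e / (`|Phi| + 1) by rewrite -g'E in fg; exact: ltW.
rewrite (le_trans (ler_wpM2l _ fg'))// mulrCA ler_piMr ?(ltW e0)//.
by rewrite ler_pdivrMr// mul1r lerDl.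
Qed.

Variables (I : Type) (F : set_system I) (FF : ProperFilter F) (e : I -> A).
Hypothesis bai : bounded_approximate_identity F e.

Lemma cvg_lucact (r : right_multiplier A) (S : dual A) (b : A) :
  lucact S b (r (e i)) @[i --> F] --> (S (r b) : R[i]^o).
Proof.
have [N /ler_normM_bound rN] := rmul_bounded r.
have -> : (fun i => lucact S b (r (e i))) = (fun i => S (r (bmul b (e i)))).
  by apply/funext => i /=; rewrite rmulM.
have [_ /(_ b)[_ be]] := bai.
apply/cvgrPdist_lt => d d0.
have K0 : 0 < `|S| * `|N| + 1 by rewrite ltr_wpDl// mulr_ge0.
have /cvgrPdist_lt/(_ (d / (`|S| * `|N| + 1)) ltac:(by rewrite divr_gt0)) := be.
apply: filterS => i bei.
rewrite -linearB (le_lt_trans (ler_dual S _))//.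
have -> : r b - r (bmul b (e i)) = r (b - (bmul b (e i))).
  by rewrite addrC -scaleN1r -(rmul_linear r) scaleN1r addrC.
move: bei; rewrite ltr_pdivlMr// mulrC; apply: le_lt_trans.
rewrite mulrDl mul1r -mulrA (@le_trans _ _ (`|S| * (`|N| * `|b - (bmul b (e i))|)))//.
  by rewrite ler_wpM2l.
by rewrite lerDl.
Qed.

Lemma bai_multiplier_bounded (N : R[i]) : 0 <= N ->
  exists2 C, 0 < C & forall r : right_multiplier A,
    (forall x, `|r x| <= N * `|x|) -> forall i, `|r (e i)| <= C.
Proof.
move=> N0; have [ebnd _] := bai; have [M M0 eM] := bounded_setP ebnd.
exists (N * M + 1); first by rewrite ltr_wpDl// mulr_ge0.
move=> r rN i; rewrite (le_trans (rN _))// (@le_trans _ _ (N * M))//.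
  by rewrite ler_wpM2l// eM//; exists i.
by rewrite lerDl.
Qed.

(* By density, and by boundedness of the r (e i), it suffices to treat the
   S . b, for which (S . b) (r (e i)) = S (r (b e_i)) tends to S (r b). *)
Lemma cvg_rmul_luc (r : right_multiplier A) (f : luc A) :
  f (r (e i)) @[i --> F] --> rmul_luc F e r f.
Proof.
have [N /ler_normM_bound rN] := rmul_bounded r.
have [C C0 /(_ r rN) rC] := bai_multiplier_bounded (normr_ge0 N).
suff [l fl] : exists l : R[i]^o, f (r (e i)) @[i --> F] --> l.
  by rewrite /rmul_luc (cvg_lim _ fl).
(* An ultrafilter finer than [F] supplies a candidate limit; comparison with some [g] that converges
   along [F] itself shows that it is the limit along [F]. *)
have [U [UU FU]] := ultraFilterLemma FF.
have [l fl] : exists l : R[i]^o, f (r (e i)) @[i --> U] --> l.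
  apply: (@ultra_cvg _ _ _ _ (`|f| * C)) => i.
  by rewrite (le_trans (ler_dual (luc_val f) _))// ler_wpM2l.
exists l.
pose L := [set g : dual A | exists l' : R[i]^o, g (r (e i)) @[i --> F] --> l'].
have sL : subspace L.
  split; first by exists 0; exact: cvg_cst.
  move=> k g h [lg gl] [lh hl]; exists (k *: lg + lh).
  exact: (cvg_comb FF gl hl).
apply/cvgrPdist_lt => eps eps0.
have eps5 : 0 < eps / 5 / C by rewrite !divr_gt0.
have /luc_predP/(_ _ eps5)[g sg fg] := lucP f.
have [l' gl'] : L g.
  apply: (span_sub sL _ sg) => _ [S _ [b _ <-]]; exists (S (r b)).
  exact: cvg_lucact.
have fgi i : `|f (r (e i)) - g (r (e i))| <= eps / 5.
  have -> : f (r (e i)) - g (r (e i)) = (luc_val f - g) (r (e i)) by [].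
  rewrite (le_trans (ler_dual _ _))// (@le_trans _ _ (eps / 5 / C * C))//.
    by rewrite ler_pM// ltW.
  by rewrite divfK// gt_eqF.
have /cvgrPdist_lt/(_ (eps / 5) ltac:(by rewrite divr_gt0)) gF := gl'.
have /cvgrPdist_lt/(_ (eps / 5) ltac:(by rewrite divr_gt0)) fU := fl.
have [i0 [/= gi0 fi0]] := filter_ex (filterI (FU _ gF) fU).
have ll' : `|l - l'| < eps / 5 + eps / 5 + eps / 5.
  have -> : l - l' = (l - f (r (e i0))) + (f (r (e i0)) - g (r (e i0))) - (l' - g (r (e i0))).
    by rewrite opprB addrA addrA subrK subrK.
  rewrite (le_lt_trans (ler_normB _ _))// ltrD// (le_lt_trans (ler_normD _ _))//.
  by rewrite ltr_leD.
apply: filterS gF => i gi.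
have -> : l - f (r (e i)) = (l - l') + (l' - g (r (e i))) - (f (r (e i)) - g (r (e i))).
  by rewrite opprB addrA addrA subrK subrK.
(* Three fifths bound [l - l'], one the convergence of [g], one the distance of [f] to [g] on the
   [r (e i)]. *)
have -> : eps = eps / 5 + eps / 5 + eps / 5 + eps / 5 + eps / 5 by field.
rewrite (le_lt_trans (ler_normB _ _))// ltr_leD// (le_lt_trans (ler_normD _ _))//.
exact: ltrD.
Qed.

Lemma rmul_luc_lucact (r : right_multiplier A) S b :
  rmul_luc F e r (lucact S b) = S (r b).
Proof. by apply: (cvg_lim (@norm_hausdorff _ _)); exact: cvg_lucact. Qed.

Lemma rmul_luc_linear (r : right_multiplier A) : linear (rmul_luc F e r).
Proof.
move=> k f g; apply: (cvg_lim (@norm_hausdorff _ _)).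
have E i : (k *: f + g : luc A) (r (e i)) = k *: f (r (e i)) + g (r (e i)) by [].
under eq_fun do rewrite E.
exact: (cvg_comb FF (@cvg_rmul_luc r f) (@cvg_rmul_luc r g)).
Qed.

Lemma ler_limit (J : Type) (G : set_system J) (GG : ProperFilter G)
    (h : J -> R[i]^o) (l : R[i]^o) (M : R[i]) :
  h @ G --> l -> (forall j, `|h j| <= M) -> `|l| <= M.
Proof.
move=> hl hM; apply/ler_addgt0Pl => d d0.
have /cvgrPdist_lt/(_ d d0) hd := hl; have [j lj] := filter_ex hd.
by rewrite -[l](subrK (h j)) (le_trans (ler_normD _ _))// lerD// ltW.
Qed.

(** Uniform boundedness lets the functionals converge pointwise along the ultrafilter to a bounded
    one. The first property identifies it as a cluster point; the second is the form in which its
    action is computed. *)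
Lemma cluster_point_exists (d : Order.disp_t) (T : orderType d)
    (a : T -> right_multiplier A) (p : set_system T) :
  bounded_multipliers a -> cofinal_ultrafilter p ->
  exists2 Psi : dual (luc A),
    (forall f, rmul_luc F e (a t) f @[t --> p] --> Psi f) &
    forall (S : dual A) b, S (a t b) @[t --> p] --> (Psi (lucact S b) : R[i]^o).
Proof.
move=> [N aN] [pU _].
have [C C0 aC] := bai_multiplier_bounded (normr_ge0 N).
have {}aC t i : `|a t (e i)| <= C by apply: aC => x; exact: (ler_normM_bound (aN t)).
have alC t f : `|rmul_luc F e (a t) f| <= C * `|f|.
  apply: (ler_limit FF (@cvg_rmul_luc (a t) f)) => i.
  by rewrite (le_trans (ler_dual (luc_val f) _))// mulrC ler_wpM2r.
have /choice[Psi PsiP] : forall f, exists l : R[i]^o,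
    rmul_luc F e (a t) f @[t --> p] --> l.
  by move=> f; apply: (@ultra_cvg _ _ _ _ (C * `|f|)).
have Plin : linear Psi.
  move=> k f g; rewrite -(cvg_lim (@norm_hausdorff _ _) (PsiP (k *: f + g))).
  apply: (cvg_lim (@norm_hausdorff _ _)).
  under eq_fun do rewrite rmul_luc_linear.
  exact: (cvg_comb _ (PsiP f) (PsiP g)).
have Pbnd : exists M : R[i], forall f, `|Psi f| <= M * `|f|.
  by exists C => f; apply: (ler_limit _ (PsiP f)).
exists (mk_dual Plin Pbnd) => [//|S b].
have := PsiP (lucact S b); under eq_fun do rewrite rmul_luc_lucact.
exact.
Qed.

End ClusterPoints.

(** * Functionals prescribed on a base *)

Section Interpolation.
Variables (R : realType) (d : Order.disp_t) (T : orderType d).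

(** The modulus of a combination of the [c t] is at most [M] times the sum of the moduli of the
    coefficients, which the base inequality controls. *)
Lemma l1_base_interpolation (V : normedModType R[i]) (x : T -> V)
    (c : T -> R[i]^o) (M : R[i]) :
  l1_base x -> (forall t, `|c t| <= M) -> exists f : dual V, forall t, f (x t) = c t.
Proof.
move=> [_ [K K0 xK]] cM.
have M0 (t : T) : 0 <= M by rewrite (le_trans _ (cM t)).
(* [|M|] replaces [M], whose sign is known only once [T] has an element. *)
have [||f fx] := @dual_extension R V (range (fun t => (x t, c t))) (`|M| * K).
  by rewrite mulr_ge0// ltW.
  have -> : range (fun t => (x t, c t)) = \bigcup_t [set (x t, c t)].
    by apply/seteqP; split=> [_ [t _ <-]|_ [t _ ->]]; exists t.
  move=> u /span_bigcup[s [y [us ys ->]]].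
  have /choice[z zy] : forall t, exists z : R[i], y t = z *: (x t, c t).
    move=> t; pose L := [set w : V * R[i]^o | exists z : R[i], w = z *: (x t, c t)].
    have sL : subspace L.
      split; first by exists 0; rewrite scale0r.
      by move=> k _ _ [z ->] [w ->]; exists (k * z + w); rewrite scalerDl scalerA.
    by apply: (span_sub sL _ (ys t)) => _ ->; exists 1; rewrite scale1r.
  under eq_bigr do rewrite zy.
  rewrite (raddf_sum (@fst _ _)) (raddf_sum (@snd _ _)) /=.
  rewrite (le_trans (ler_norm_sum _ _ _))// -mulrA.
  rewrite (le_trans _ (ler_wpM2l _ (xK s z us)))//.
  rewrite mulr_sumr ler_sum// => t _.
  by rewrite normrZ mulrC ler_wpM2r// (le_trans (cM t))// real_ler_norm// ger0_real// (M0 t).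
by exists f => t; rewrite (fx (x t, c t))//; exists t.
Qed.

(** Restricting a sum of [f (x_t)] to [P] keeps it below [|f|] times the sum of the [|x_t|], hence
    below [|f| * K] times the norm of the sum of the [x_t]. *)
Lemma selective_base_mask (V : normedModType R[i]) (L : T -> set V)
    (P : set T) (f : dual V) :
  l1_selective_base L ->
  exists g : dual V, forall t x, L t x -> g x = if `[< P t >] then f x else 0.
Proof.
move=> [_ _ _ [K K0 LK]].
pose G t := [set u : V * R[i]^o | L t u.1 /\ u.2 = if `[< P t >] then f u.1 else 0].
have [|u|g gG] := @dual_extension R V (\bigcup_t G t) (`|f| * K).
- by rewrite mulr_ge0// ltW.
- move=> /span_bigcup[s [y [us ys ->]]].
  have yG t : Defs.span (L t) (y t).1 /\
      (y t).2 = if `[< P t >] then f (y t).1 else 0.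
    pose H := [set u : V * R[i]^o | Defs.span (L t) u.1 /\
      u.2 = if `[< P t >] then f u.1 else 0].
    have sH : subspace H.
      split; first by split=> /=; [exact: Defs.span0|rewrite linear0 if_same].
      move=> k v w [Lv vE] [Lw wE]; split; first exact: Defs.spanP.
      rewrite /= vE wE; case: ifP => _; last by rewrite scaler0 addr0.
      by rewrite linearP.
    apply: (span_sub sH _ (ys t)) => v [Lv vE]; split=> //.
    exact: sub_span.
  rewrite (raddf_sum (@fst _ _)) (raddf_sum (@snd _ _)) /=.
  rewrite (le_trans (ler_norm_sum _ _ _))// -mulrA.
  have := LK s (fun t => (y t).1) us (fun t _ => (yG t).1).
  move=> /(ler_wpM2l (normr_ge0 f)); apply: le_trans.
  rewrite mulr_sumr ler_sum// => t _; have [_ ->] := yG t.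
  case: ifP => _; first exact: ler_dual.
  by rewrite normr0 mulr_ge0.
- exists g => t x Lx; rewrite (gG (x, if `[< P t >] then f x else 0))//.
  by exists t.
Qed.

Variables (A : banachAlgType R[i]) (m : nat).
Variables (AA : T -> set A) (a : 'I_m -> T -> right_multiplier A).

(** Hahn-Banach on [A^m] with the 1-norm, for the prescription that sends the row of the [a k t x]
    to [f x]. The bound comes from [K2] for each [t], then from the selective inequality for each
    [k] separately; the [g k] are the restrictions to the coordinates. *)
Lemma selective_base_factorization (K2 : R[i]) (f : dual A) :
  l1_selective_base (fun t => \bigcup_k (a k t @` AA t)) -> 0 < K2 ->
  (forall t x, Defs.span (AA t) x -> `|x| <= K2 * \sum_(k < m) `|a k t x|) ->
  exists g : 'I_m -> dual A, forall t x, AA t x -> \sum_k g k (a k t x) = f x.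
Proof.
move=> [_ _ _ [K1 K10 LK1]] K20 aK2.
pose L t := \bigcup_k (a k t @` AA t).
pose row t x : {ffun 'I_m -> A} := [ffun k => a k t x].
pose G t := [set u : {ffun 'I_m -> A} * R[i]^o |
  exists2 x, AA t x & u = (row t x, f x)].
pose C : R[i] := `|f| * K2 * K1.
have C0 : 0 <= C by rewrite !mulr_ge0// ltW.
pose p (v : {ffun 'I_m -> A}) := complex.Re (C * \sum_k `|v k|).
have pE v : (p v)%:C = C * \sum_k `|v k|.
  by apply: ge0_Re; rewrite mulr_ge0// sumr_ge0.
have [|||h [hlin hp hG]] := @hahn_banach R {ffun 'I_m -> A} p _ _ (\bigcup_t G t).
- move=> x y; rewrite -lecR rmorphD /= !pE -mulrDr ler_wpM2l// -big_split ler_sum// => k _.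
  by rewrite ffunE ler_normD.
- move=> k x; rewrite !pE mulrCA; congr (_ * _); rewrite mulr_sumr.
  by apply: eq_bigr => l _; rewrite ffunE normrZ.
- move=> u /span_bigcup[s [y [us ys ->]]].
  have /choice[x xP] : forall t, exists x, Defs.span (AA t) x /\ y t = (row t x, f x).
    move=> t.
    pose H := [set u : {ffun 'I_m -> A} * R[i]^o |
      exists x, Defs.span (AA t) x /\ u = (row t x, f x)].
    have rlin : linear (row t).
      by move=> k v w; apply/ffunP => l; rewrite !ffunE rmul_linear.
    have sH : subspace H.
      split.
        exists 0; split; first exact: Defs.span0.
        by rewrite linear0 (linear_map0 rlin).
      move=> k _ _ [v [Av ->]] [w [Aw ->]]; exists (k *: v + w).
      by split; [exact: Defs.spanP|rewrite rlin linearP].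
    apply: (span_sub sH _ (ys t)) => _ [v Av ->].
    by exists v; split=> //; exact: sub_span.
  have Lx k t : Defs.span (L t) (a k t (x t)).
    have sLk : subspace [set v | Defs.span (L t) (a k t v)].
      have alin := rmul_linear (a k t).
      split=> [|c v w Lv Lw]; last by rewrite /= alin; exact: Defs.spanP.
      by rewrite /= (linear_map0 alin); exact: Defs.span0.
    apply: (span_sub sLk _ (xP t).1) => v Av; apply: sub_span.
    by exists k => //; exists v.
  rewrite pE (raddf_sum (@fst _ _)) (raddf_sum (@snd _ _)) /=.
  rewrite (le_trans (ler_norm_sum _ _ _))//.
  have -> : C * \sum_k `|(\sum_(t <- s) (y t).1) k| =
      `|f| * K2 * \sum_k (K1 * `|\sum_(t <- s) a k t (x t)|).
    rewrite -mulr_sumr mulrA; congr (_ * _); apply: eq_bigr => k _.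
    rewrite sum_ffunE; congr `| _ |; apply: eq_bigr => t _.
    by rewrite (xP t).2 ffunE.
  have : \sum_k \sum_(t <- s) `|a k t (x t)| <=
      \sum_k (K1 * `|\sum_(t <- s) a k t (x t)|).
    by apply: ler_sum => k _; apply: LK1 => // t _; exact: Lx.
  have fK0 : 0 <= `|f| * K2 by rewrite mulr_ge0// ltW.
  move=> /(ler_wpM2l fK0); apply: le_trans.
  rewrite exchange_big /= mulr_sumr ler_sum// => t _.
  rewrite (xP t).2 /= (le_trans (ler_dual _ _))// -mulrA ler_wpM2l//.
  exact: aK2 (xP t).1.
pose delta k (x : A) : {ffun 'I_m -> A} := [ffun l => if l == k then x else 0].
have glin k : linear (h \o delta k).
  move=> c x y /=; rewrite -hlin; congr h.
  by apply/ffunP => l; rewrite !ffunE; case: ifP => // _; rewrite scaler0 addr0.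
have gbnd k : exists M : R[i], forall x, `|(h \o delta k) x| <= M * `|x|.
  exists C => x; rewrite (le_trans (hp _))// pE ler_wpM2l//.
  rewrite (bigD1 k)//= big1 => [|l /negPf lk]; last by rewrite ffunE lk normr0.
  by rewrite addr0 ffunE eqxx.
exists (fun k => mk_dual (glin k) (gbnd k)) => t x Ax /=.
rewrite -(linear_map_sum hlin).
have -> : \sum_k delta k (a k t x) = row t x.
  apply/ffunP => l; rewrite sum_ffunE (bigD1 l)//= big1 => [|k /negPf kl].
    by rewrite addr0 !ffunE eqxx.
  by rewrite ffunE eq_sym kl.
by rewrite (hG (row t x, f x))//; exists t => //; exists x.
Qed.

(** Together with [factorization_property], the zooming family and the boundedness of the
    multipliers, this is all that the construction of the ideals uses of a base, whatever its
    type. *)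
Definition mask_property := forall (P : set T) (f : dual A),
  exists g : dual A, forall k t x, AA t x ->
    g (a k t x) = if `[< P t >] then f (a k t x) else 0.

Definition factorization_property := forall f : dual A,
  exists g : 'I_m -> dual A, forall t x, AA t x -> \sum_k g k (a k t x) = f x.

Lemma selective_base_properties :
  l1_selective_base (fun t => \bigcup_k (a k t @` AA t)) ->
  (exists2 K2 : R[i], 0 < K2 & forall t x, Defs.span (AA t) x ->
     `|x| <= K2 * \sum_(k < m) `|a k t x|) ->
  mask_property /\ factorization_property.
Proof.
move=> sel [K2 K20 aK2]; split=> [P f|f].
  have [g gP] := selective_base_mask P f sel.
  by exists g => k t x Ax; apply: gP; exists k => //; exists x.
exact: selective_base_factorization sel K20 aK2.
Qed.

End Interpolation.

(** For type 1 both properties prescribe bounded values on the enumerated base: boundedness of the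
    base serves for the mask, that of the sets [AA t] for the factorization. Type 2 is reduced to
    the selective case with [m = 1]. *)
Lemma fl1_base_properties (R : realType) (d : Order.disp_t) (T : orderType d)
    (A : banachAlgType R[i]) (m : nat) (AA : T -> set A)
    (a : 'I_m -> T -> right_multiplier A) :
  (0 < m)%N -> fl1_base_type12 AA a \/ fl1_base_type3 AA a ->
  [/\ zooming_family AA, forall k, bounded_multipliers (a k),
      mask_property AA a & factorization_property AA a].
Proof.
move=> m0 [[m1 base]|base]; last first.
  have [? ? _ sel K2] := base.
  by have [] := selective_base_properties sel K2; split.
rewrite {}m1 {m m0} in a base *.
suff [[zoom bnd _] [msk fac]] : zooming_set AA (a ord0) /\
    mask_property AA a /\ factorization_property AA a.
  by split=> // k; rewrite (ord1 k).
case: base => /(_ ord0).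
  move=> [zoom [e [[efun _ esurj] l1]]]; split=> //.
  have [[_ Abnd _] _ _] := zoom.
  have [N N0 abnd] := bounded_setP l1.1; have [M M0 AAM] := bounded_setP Abnd.
  have eAA t x : AA t x -> exists u, e u = (t, x).
    by move=> Ax; have [u _ <-] := esurj (t, x) Ax; exists u.
  split=> [P f|f].
    have [|g gP] := @l1_base_interpolation _ _ _ _ _
      (fun t => if `[< P (e t).1 >] then f (a ord0 (e t).1 (e t).2) else 0)
      (`|f| * N) l1.
      move=> t; case: ifP => _; last by rewrite normr0 mulr_ge0.
      rewrite (le_trans (ler_dual _ _))// ler_wpM2l//.
      by apply: abnd; exists t.
    by exists g => k t x /eAA[u eu]; rewrite (ord1 k); have := gP u; rewrite eu.
  have [|g gP] := @l1_base_interpolation _ _ _ _ _ (fun t => f (e t).2)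
    (`|f| * M) l1.
    move=> t; rewrite (le_trans (ler_dual _ _))// ler_wpM2l//.
    by apply: AAM; exists (e t).1 => //; exact: efun.
  exists (fun=> g) => t x /eAA[u eu]; rewrite big_ord1.
  by have := gP u; rewrite eu.
move=> [zoom sel [K2 K20 aK2]]; split=> //.
apply: selective_base_properties.
  suff <- : (fun t => a ord0 t @` AA t) = (fun t => \bigcup_k (a k t @` AA t)) by [].
  apply/funext => t; apply/seteqP; split=> [x ax|x [k _]]; first by exists ord0.
  by rewrite (ord1 k).
by exists K2 => // t x Ax; rewrite big_ord1; exact: aK2.
Qed.

(** * Common treatment of the two Arens products *)

Section FactorizingActions.
Variables (R : realType) (A : banachAlgType R[i]).
Variables (V : lmodType R[i]) (mul : V -> V -> V).
Variables (act : V -> dual A -> dual A).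
Variables (Q : Type) (ev : V -> Q -> dual A -> R[i]^o).
Hypothesis ev_mul : forall x y q S, ev (mul x y) q S = ev x q (act y S).
Hypothesis ev_inj : forall x y, (forall q S, ev x q S = ev y q S) -> x = y.
Hypothesis ev_linearl : forall q S, linear (fun x => ev x q S).
Hypothesis ev_linearr : forall x q, linear (ev x q).
Hypothesis act_linearl : forall S, linear (act^~ S).
Variables (d : Order.disp_t) (T : orderType d).
Hypothesis eta : infinite_initial_ordinal T.
Variables (m : nat) (p : set (set T) -> set_system T).
Variable psi : set (set T) -> 'I_m -> V.
Hypothesis p_ultra : forall j, UltraFilter (p j).
Hypothesis p_inj : injective p.
Hypothesis mask : forall (P : set T) S, exists S', forall j k,
  (p j P -> act (psi j k) S' = act (psi j k) S) /\
  (p j (~` P) -> act (psi j k) S' = 0).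
Hypothesis factor : forall S0, exists S : 'I_m -> dual A,
  forall j, \sum_k act (psi j k) (S k) = S0.
Hypothesis nontrivial : exists S : dual A, S != 0.

(** The map [ev] tests an element of [V] on functionals: for the bidual it is evaluation at [S],
    with a trivial index [q]; for the dual of LUC(A) it is evaluation at [S . q] with [q] in [A],
    since these span a dense subspace. [ev_mul] is then the definition of the Arens product. *)
Lemma many_left_ideals_of_action (disj : Prop) (S : set V) :
  (forall j k, S (psi j k)) -> subsemigroup mul S \/ subalgebra mul S ->
  many_principal_left_ideals mul (set (set T)) disj S.
Proof.
have ev0l q S0 : ev 0 q S0 = 0 by exact: (linear_map0 (ev_linearl q S0)).
have ev0r x q : ev x q 0 = 0 by exact: (linear_map0 (ev_linearr x q)).
have [c cinj] : exists c : set (set T) -> set (set T) -> set (set T),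
    forall P Q P' Q', c P Q = c P' Q' -> P = P' /\ Q = Q'.
  by apply: infinite_power_square; case: eta.
have nz j : exists k S0, act (psi j k) S0 != 0.
  have [S0 S00] := nontrivial; have [S1 S1E] := factor S0.
  apply: contrapT => nz; move/eqP: S00; apply; rewrite -(S1E j) big1 // => k _.
  by apply: contrapT => /eqP nz'; apply: nz; exists k, (S1 k).
have /choice[kappa kappaP] := nz.
apply: (@many_left_ideals _ _ mul _ _ set0 c cinj m psi kappa) => [z|||].
- move=> k x y; apply: ev_inj => q S0.
  by rewrite ev_mul !(ev_linearl q) !ev_mul.
- move=> i j k l x y ij E; apply: ev_inj => q S0; rewrite ev0l.
  pose pb (b : bool) := p (if b then i else j).
  have pb_inj : injective pb by move=> [] [] // /p_inj // /esym.
  have [P pP nP] := separate_ultrafilters true (fun b => p_ultra _) pb_inj.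
  have [S' S'P] := mask P S0.
  rewrite ev_mul -((S'P i k).1 pP) -ev_mul E ev_mul.
  by rewrite ((S'P j l).2 (nP false isT)).
- move=> i x xi; apply: ev_inj => q S0; rewrite ev0l.
  have [S1 S1E] := factor S0; rewrite -(S1E i).
  rewrite (linear_map_sum (ev_linearr x q)) big1 // => k _.
  by rewrite -ev_mul xi.
- move=> n z x xinj sum0 i; have [S0 S00] := kappaP (x i).
  have [P pP nP] := separate_ultrafilters i (fun j => p_ultra (x j)) (inj_comp p_inj xinj).
  have [S' S'P] := mask P S0.
  have := congr1 (act^~ S') sum0.
  have alin := @act_linearl S'.
  rewrite (linear_map_sum alin) (linear_map0 alin) (bigD1 i)//= big1 => [|j ji]; last first.
    by rewrite (linear_mapZ alin) ((S'P _ _).2 (nP j ji)) scaler0.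
  rewrite addr0 (linear_mapZ alin) ((S'P _ _).1 pP) => /eqP.
  by rewrite scaler_eq0 (negPf S00) orbF => /eqP.
Qed.

End FactorizingActions.

(** * Sums and uniqueness of complex limits *)

Section Limits.
Variables (R : realType) (J : Type) (G : set_system J).
Hypothesis GG : ProperFilter G.

Lemma cvg_sum_complex (I : Type) (r : seq I) (h : I -> J -> R[i]^o)
    (l : I -> R[i]^o) :
  (forall i, h i @ G --> l i) ->
  (\sum_(i <- r) h i j) @[j --> G] --> \sum_(i <- r) l i.
Proof.
move=> hl; elim: r => [|i r IHr].
  rewrite big_nil; under eq_fun do rewrite big_nil.
  exact: cvg_cst.
rewrite big_cons; under eq_fun do rewrite big_cons.
have := cvg_comb GG (k := 1) (hl i) IHr.
by rewrite scale1r; under eq_fun do rewrite scale1r.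
Qed.

Lemma cvg_near_unique (h h' : J -> R[i]^o) (l l' : R[i]^o) :
  h @ G --> l -> h' @ G --> l' -> (\forall j \near G, h j = h' j) -> l = l'.
Proof.
move=> hl hl' hh'; apply/eqP; rewrite -subr_eq0 -normr_le0.
apply/ler_addgt0Pl => d d0; rewrite addr0.
have d2 : 0 < d / 2 by rewrite divr_gt0.
have /cvgrPdist_lt/(_ _ d2) hd := hl; have /cvgrPdist_lt/(_ _ d2) hd' := hl'.
have [j [[/= ld ld'] hh'j]] := filter_ex (filterI (filterI hd hd') hh').
rewrite -(subrK (h j) l) -addrA (le_trans (ler_normD _ _))// [d]splitr.
by rewrite lerD// ltW// hh'j distrC.
Qed.

End Limits.

(** * The action of cluster points on the dual of A *)

Section ClusterPointActions.
Variables (R : realType) (A : banachAlgType R[i]).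
Variables (d : Order.disp_t) (T : orderType d) (AA : T -> set A).
Hypothesis zoom : zooming_family AA.
Variable p : set_system T.
Hypothesis p_cof : cofinal_ultrafilter p.

(** This is where cofinality meets monotonicity of [AA]: a tail belongs to [p]. *)
Lemma near_zooming t0 x : AA t0 x -> \forall t \near p, AA t x.
Proof.
move=> Ax; have [incr _ _] := zoom.
apply: (@filterS _ p _ [set t | (t0 <= t)%O]); last exact: cofinal_ultrafilter_tail.
  by case: p_cof => ? _; exact: filter_filter.
by move=> t /incr; exact.
Qed.

(** At [x] in some [AA t0], the action is the limit of [S (a t x)] along [p], and [x] is in [AA t]
    for [p]-almost all [t]; density of the span concludes. *)
Lemma lucdact_near_eq (a : T -> right_multiplier A) (Psi : dual (luc A))
    (S S' : dual A) :
  (forall (S : dual A) b, S (a t b) @[t --> p] --> (Psi (lucact S b) : R[i]^o)) ->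
  (\forall t \near p, forall x, AA t x -> S (a t x) = S' (a t x)) ->
  lucdact Psi S = lucdact Psi S'.
Proof.
move=> aPsi SS'; have [pU _] := p_cof; have [_ _ dense] := zoom.
apply: (dual_eq_dense dense) => x [t0 _ Ax].
apply: (cvg_near_unique _ (aPsi S x) (aPsi S' x)).
by apply: filterS2 SS' (near_zooming Ax) => t; exact.
Qed.

Lemma sum_lucdact (m : nat) (a : 'I_m -> T -> right_multiplier A)
    (Psi : 'I_m -> dual (luc A)) (S : 'I_m -> dual A) (S0 : dual A) :
  (forall k (S : dual A) b,
     S (a k t b) @[t --> p] --> (Psi k (lucact S b) : R[i]^o)) ->
  (forall t x, AA t x -> \sum_k S k (a k t x) = S0 x) ->
  \sum_k lucdact (Psi k) (S k) = S0.
Proof.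
move=> aPsi SE; have [pU _] := p_cof; have [_ _ dense] := zoom.
apply: (dual_eq_dense dense) => x [t0 _ Ax].
have evx : linear (fun f : dual A => f x) by [].
rewrite (linear_map_sum evx).
have pF : ProperFilter p by exact: ultra_proper.
have lim_sum := cvg_sum_complex (r := index_enum 'I_m) pF (fun k => aPsi k (S k) x).
apply: (cvg_near_unique pF lim_sum (cvg_cst _)).
by apply: filterS (near_zooming Ax) => t; exact: SE.
Qed.

End ClusterPointActions.

(** * The ideals in the dual of LUC(A) and in the bidual *)

Theorem theorem5p3 (R : realType) (A : banachAlgType R[i])
    (A_neq0 : exists x : A, x != 0)
    (I : Type) (F : set_system I) (FF : ProperFilter F) (e : I -> A)
    (bai : bounded_approximate_identity F e)
    (d : Order.disp_t) (T : orderType d) (eta : infinite_initial_ordinal T)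
    (m : nat) (m_gt0 : (0 < m)%N)
    (AA : T -> set A) (a : 'I_m -> T -> right_multiplier A)
    (base : fl1_base_type12 AA a \/ fl1_base_type3 AA a)
    (X := \bigcup_k cluster_points F e (a k))
    (ext : dual (luc A) -> dual (dual A))
    (extP : forall Psi, X Psi ->
       (forall f : luc A, ext Psi (luc_val f) = Psi f) /\
       `|ext Psi| = `|Psi|) :
  (forall S : set (dual (luc A)), X `<=` S ->
     subsemigroup (@arens_luc R A) S \/ subalgebra (@arens_luc R A) S ->
     many_principal_left_ideals (@arens_luc R A) (set (set T))
       (fl1_base_type12 AA a) S) /\
  (forall S : set (dual (dual A)), ext @` X `<=` S ->
     subsemigroup (@arens R A) S \/ subalgebra (@arens R A) S ->
     many_principal_left_ideals (@arens R A) (set (set T))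
       (fl1_base_type12 AA a) S).
Proof.
have [zoom abnd msk fac] := fl1_base_properties m_gt0 base.
have [p [p_cof p_inj]] := cofinal_ultrafilters eta.
have p_ultra j : UltraFilter (p j) by have [] := p_cof j.
have /choice[psi psiP] : forall j, exists psi : 'I_m -> dual (luc A), forall k,
    (forall f, rmul_luc F e (a k t) f @[t --> p j] --> psi k f) /\
    forall (S : dual A) b,
      S (a k t b) @[t --> p j] --> (psi k (lucact S b) : R[i]^o).
  move=> j; suff /choice[psi psiP] : forall k, exists Psi : dual (luc A),
      (forall f, rmul_luc F e (a k t) f @[t --> p j] --> Psi f) /\
      forall (S : dual A) b,
        S (a k t b) @[t --> p j] --> (Psi (lucact S b) : R[i]^o) by exists psi.
  move=> k; have [Psi ? ?] := cluster_point_exists FF bai (abnd k) (p_cof j).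
  by exists Psi.
have psiX j k : X (psi j k).
  by exists k => //; exists (p j) => // f; have [+ _] := psiP j k; exact.
have psi_lim j k := (psiP j k).2.
have mask (P : set T) (S : dual A) : exists S' : dual A, forall j k,
    (p j P -> lucdact (psi j k) S' = lucdact (psi j k) S) /\
    (p j (~` P) -> lucdact (psi j k) S' = 0).
  have [S' S'P] := msk P S; exists S' => j k; split=> pP.
    apply: (lucdact_near_eq zoom (p_cof j) (psi_lim j k)).
    by apply: filterS pP => t /asboolT Pt x /S'P ->; rewrite Pt.
  have <- : lucdact (psi j k) 0 = 0.
    exact: linear_map0 (lucdact_linearP (psi j k)).
  apply: (lucdact_near_eq zoom (p_cof j) (psi_lim j k)).
  by apply: filterS pP => t /asboolF Pt x /S'P ->; rewrite Pt.
have factor (S0 : dual A) : exists S : 'I_m -> dual A,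
    forall j, \sum_k lucdact (psi j k) (S k) = S0.
  have [S SE] := fac S0; exists S => j.
  exact: (sum_lucdact zoom (p_cof j) (psi_lim j)).
have nontrivial : exists S : dual A, S != 0.
  have [x /dual_separates[S Sx]] := A_neq0; exists S.
  by apply: contraNneq Sx => ->.
split=> S XS SS.
- apply: (@many_left_ideals_of_action R A _ _ (@lucdact R A) A
    (fun Phi q S => Phi (lucact S q)) _ _ _ _ _ d T eta m p psi) => //.
  + move=> x y q S0 /=; congr (x _); apply: val_inj => /=.
    exact: lucdact_ract.
  + move=> x y xy; apply/eqP; rewrite -subr_eq0; apply/eqP.
    apply: luc_separates => S0 b; have -> : (x - y) (lucact S0 b) =
      x (lucact S0 b) - y (lucact S0 b) by [].
    by rewrite xy subrr.
  + move=> x q k S0 S1; rewrite -linearP; congr (x _); apply: val_inj => /=.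
    exact: ract_linearl.
  + by move=> S0 k x y; apply: dualP.
  + by move=> j k; apply: XS.
(* Each [S0 . b] is in LUC(A), so an extension acts on the dual of [A] exactly as the cluster point
   does; masking and factorization carry over. *)
- have extE j k S0 : biact (ext (psi j k)) S0 = lucdact (psi j k) S0.
    apply: dualP => b /=; have [extE _] := extP _ (psiX j k).
    exact: extE (lucact S0 b).
  apply: (@many_left_ideals_of_action R A _ _ (@biact R A) unit
    (fun Phi _ S => Phi S) _ _ _ _ _ d T eta m p (fun j k => ext (psi j k))) => //.
  + by move=> x y xy; apply: dualP => S0; exact: xy tt S0.
  + by move=> x _ k S0 S1; rewrite linearP.
  + by move=> S0 k x y; apply: dualP.
  + move=> P S0; have [S' S'P] := mask P S0; exists S' => j k.
    by rewrite !extE.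
  + move=> S0; have [S1 S1E] := factor S0; exists S1 => j.
    by rewrite -[RHS](S1E j); apply: eq_bigr => k _; rewrite extE.
  + by move=> j k; apply: XS; exists (psi j k).
Qed.
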